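(* Let $\Omega$ be a finite set of arbitrary cardinality, $m\in\Delta(\Omega)$, $\lambda\in[0,1)$, and consider the irreducible Markov chain on $\Omega$ with transitions $\pi(\omega\mid\omega)=(1-\lambda)m(\omega)+\lambda$ and $\pi(\omega'\mid\omega)=(1-\lambda)m(\omega')$ for $\omega'\ne\omega$ (so $\phi(p)=m+\lambda(p-m)$). Let $r:\Omega\to\mathbb{R}$, $\delta\in[0,1)$, and let $p_1\in\Delta(\Omega)$ be an arbitrary initial belief. Then there exist a strategy $\sigma$ that is optimal at $p_1$ and a stopping time $\theta$ (with respect to the history of the decision problem) that is almost surely finite under $\sigma$, such that from stage $\theta$ on $\sigma$ coincides with the greedy strategy $\sigma_*$.
   Context: Identify each $\omega\in\Omega$ with a unit vector of $\mathbb{R}^\Omega$ and $\Delta(\Omega)$ with the unit simplex. For $p\in\Delta(\Omega)$ let $\langle p,r\rangle=\sum_\omega p(\omega)r(\omega)$; $I=\{p:\langle p,r\rangle\ge0\}$, $J=\Delta(\Omega)\setminus I$. $\phi(q)=qM$ with $M$ the transition matrix. $\mathcal{S}(p)$ is the set of Borel probability measures on $\Delta(\Omega)$ with mean $p$, $\mu_p$ the Dirac mass at $p$. Decision problem from $p_1$: at each stage $n$, at belief $p_n$, the advisor chooses $\mu\in\mathcal{S}(p_n)$ (possibly depending on the past), a posterior $q_n\sim\mu$ is drawn, the stage payoff is $\mathbf{1}_{\{q_n\in I\}}$, and $p_{n+1}=\phi(q_n)$. A strategy's payoff is $\mathbb{E}[(1-\delta)\sum_{n\ge1}\delta^{n-1}\mathbf{1}_{\{q_n\in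 I\}}]$; $V_\delta(p_1)$ is the maximal payoff; a strategy is optimal at $p_1$ if it achieves $V_\delta(p_1)$. The greedy strategy $\sigma_*$ (stationary in the belief): at $p\in I$ choose $\mu_p$; at $p\in J$ choose a two-point splitting $p=a_Iq_I+a_Jq_J$ (posterior $q_I$ w.p. $a_I$, $q_J$ w.p. $a_J$) maximizing $a_I$ subject to $q_I\in I$, $q_J\in\Delta(\Omega)$, $a_I+a_J=1$, $a_I,a_J\ge0$.
   Formalization: The formal theorem assumes that I is nonempty (some r(ω) ≥ 0); if I is empty, the maximization defining the greedy strategy σ_* has no feasible point and σ_* is undefined. *)

(* Defs.v *)
From HB Require Import structures.
From mathcomp Require Import all_boot all_order all_algebra.
From mathcomp Require Import all_classical all_reals all_analysis.
From mathcomp Require Import measurable_realfun.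

Set Implicit Arguments.
Unset Strict Implicit.
Unset Printing Implicit Defensive.

Import Order.TTheory GRing.Theory Num.Theory.
Local Open Scope classical_set_scope.
Local Open Scope ring_scope.

Section Defs.
Variables (R : realType) (Om : finType).

(* ---------- beliefs: vectors of R^Om, Borel (= product) sigma-algebra ---- *)
Definition vec := Om -> R.
HB.instance Definition _ := gen_eqMixin vec.
HB.instance Definition _ := gen_choiceMixin vec.
HB.instance Definition _ := isPointed.Build vec (fun _ => 0).
Definition pth := nat -> vec.
HB.instance Definition _ := gen_eqMixin pth.
HB.instance Definition _ := gen_choiceMixin pth.
HB.instance Definition _ := isPointed.Build pth (fun _ _ => 0).

Definition coord_gen : set (set vec) :=
  [set A | exists (w : Om) (B : set R), measurable B /\ A = [set q | B (q w)]].
Definition Belief : measurableType _ := g_sigma_algebraType coord_gen.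

Definition simplex : set (Om -> R) :=
  [set p | (forall w, 0 <= p w) /\ \sum_(w : Om) p w = 1].

Definition dotr (p r : Om -> R) : R := \sum_(w : Om) p w * r w.

Definition inI (r : Om -> R) : set (Om -> R) :=
  [set p | simplex p /\ 0 <= dotr p r].

(* transition matrix M w w' = pi(w' | w) *)
Definition trans (lam : R) (m : Om -> R) (w w' : Om) : R :=
  if w' == w then (1 - lam) * m w + lam else (1 - lam) * m w'.

Definition phi (M : Om -> Om -> R) (q : Om -> R) : Om -> R :=
  fun w' => \sum_(w : Om) q w * M w w'.

Fixpoint mpow (M : Om -> Om -> R) (n : nat) : Om -> Om -> R :=
  match n with
  | 0%N => fun w w' => if w == w' then 1 else 0
  | k.+1 => fun w w'' => \sum_(w' : Om) mpow M k w w' * M w' w''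
  end.

Definition irreducible (M : Om -> Om -> R) : Prop :=
  forall w w', exists n, 0 < mpow M n w w'.

Definition splitting (p : Om -> R) (mu : probability Belief R) : Prop :=
  mu (simplex : set Belief) = 1%E /\
  forall w, (\int[mu]_q ((q : vec) w)%:E = (p w)%:E)%E.

(* stage n (0-indexed) draws the posterior x n; the history available at     *)
(* stage n is (x 0, ..., x (n-1)).                                           *)
Definition path_gen : set (set pth) :=
  [set A | exists (k : nat) (w : Om) (B : set R),
      measurable B /\ A = [set x | B (x k w)]].
Definition Path : measurableType _ := g_sigma_algebraType path_gen.

Definition hist_gen (n : nat) : set (set (nat -> Om -> R)) :=
  [set A | exists (k : nat) (w : Om) (B : set R),
      (k < n)%N /\ measurable B /\ A = [set x | B (x k w)]].
Definition hist_sets (n : nat) : set (set (nat -> Om -> R)) :=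
  <<s hist_gen n >>.

Definition hist_ok (n : nat) (x : nat -> Om -> R) : Prop :=
  forall k, (k < n)%N -> simplex (x k).

Definition belief (M : Om -> Om -> R) (p1 : Om -> R) (n : nat)
    (x : nat -> Om -> R) : Om -> R :=
  match n with 0%N => p1 | k.+1 => phi M (x k) end.

(* sigma n x = the splitting chosen at stage n after history x 0 .. x (n-1) *)
Definition strategy := nat -> Path -> probability Belief R.

Definition strategy_ok (M : Om -> Om -> R) (p1 : Om -> R) (s : strategy)
  : Prop :=
  (forall n (x y : Path), (forall k, (k < n)%N -> x k = y k) -> s n x = s n y) /\
  (forall n (B : set Belief), measurable B ->
     forall Y : set (\bar R), measurable Y ->
       hist_sets n ((fun x : Path => s n x B) @^-1` Y)) /\
  (forall n (x : Path), hist_ok n x -> splitting (belief M p1 n x) (s n x)).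

(* P is the law of the history induced by the strategy s (Ionescu-Tulcea):   *)
(* the conditional law of q_n given the past is s n.                         *)
Definition induced_law (s : strategy) (P : probability Path R) : Prop :=
  forall n (A : set Path) (B : set Belief),
    hist_sets n A -> measurable B ->
    P (A `&` [set x : Path | B (x n)]) = (\int[P]_(x in A) s n x B)%E.

Definition payoff (r : Om -> R) (delta : R) (P : probability Path R) : \bar R :=
  (\int[P]_x
     \sum_(0 <= n <oo) ((1 - delta) * delta ^+ n * \1_(inI r) (x n))%:E)%E.

Definition value (M : Om -> Om -> R) (r : Om -> R) (delta : R) (p1 : Om -> R)
  : \bar R :=
  ereal_sup [set v | exists (s : strategy) (P : probability Path R),
                strategy_ok M p1 s /\ induced_law s P /\ v = payoff r delta P].

Definition feasible (r p : Om -> R) (aI : R) (qI qJ : Om -> R) : Prop :=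
  0 <= aI <= 1 /\ inI r qI /\ simplex qJ /\
  forall w, p w = aI * qI w + (1 - aI) * qJ w.

Definition greedy (r p : Om -> R) (mu : probability Belief R) : Prop :=
  (inI r p -> forall B : set Belief, measurable B ->
      mu B = @dirac _ Belief (p : Belief) R B) /\
  (~ inI r p -> exists (aI : R) (qI qJ : Om -> R),
      feasible r p aI qI qJ /\
      (forall a q q', feasible r p a q q' -> a <= aI) /\
      forall B : set Belief, measurable B ->
        mu B = (aI%:E * @dirac _ Belief (qI : Belief) R B
               + (1 - aI)%:E * @dirac _ Belief (qJ : Belief) R B)%E).

Definition stopping_time (theta : Path -> option nat) : Prop :=
  forall n, hist_sets n [set x | exists k, (k <= n)%N /\ theta x = Some k].

End Defs.

(* Main.v *)
Require Import Defs.
From HB Require Import structures.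
From mathcomp Require Import all_boot all_order all_algebra.
From mathcomp Require Import all_classical all_reals all_analysis.
From mathcomp Require Import measurable_realfun ring lra.
Set Implicit Arguments.
Unset Strict Implicit.
Unset Printing Implicit Defensive.
Import Order.TTheory GRing.Theory Num.Theory.
Import numFieldNormedType.Exports.
Local Open Scope classical_set_scope.
Local Open Scope ring_scope.

(* For [b >= 0] the linear form [dual b p], the sum over the states w of
   [p w * max 0 (1 + b * r w)], bounds the probability with which the posterior
   can be sent to I from the belief [p]; the least of these bounds over finitely
   many values of [b] is attained by the greedy splitting.  On the cone [cell b]
   where [dual b] is the least one, the greedy posteriors stay in the cone, and
   if [m] lies in it so does their image under [phi].  Hence from a belief in
   such a cone greedy play collects [dual b] of the average belief at every
   stage, which no strategy can exceed.

   It remains to reach one of these cones.  Fix [c] with [m] in [cell c] and let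
   [loss c] be the gap between the resulting linear upper bound and the value.
   The gap is convex, positively homogeneous, zero at [m], and additive along
   optimal splittings, so [phi p = lam p + (1 - lam) m] contracts it by [lam] in
   expectation.  It is bounded below on posteriors whose image under [phi] is in
   none of the cones, so by Markov's inequality the probability of not having
   reached a cone decays geometrically.

   The value is that of a linear program over trees of unnormalised posteriors
   indexed by the pattern of visits to I: averaging an arbitrary strategy over
   each pattern gives such a tree, and an optimal tree exists by compactness. *)

(** Beliefs are kept unnormalised: on nonnegative vectors [phi] is linear, a splitting is just a sum
    [x \+ y], and the value is positively homogeneous and superadditive, hence concave.
    Normalisation returns only when posteriors have to be drawn. The cones survive one step because
    [0 <= lam] makes [phi x] a nonnegative combination of [x] and [m]; this is where the form of the
    chain enters. The uniform lower bound on the gap rests on [delta < 1], [lam < 1] and the finite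
    number of kinks. The obstacle is measurability: Bellman's equation provides an optimal splitting
    at each belief through choice only. From [p1], however, two-point splittings reach countably
    many histories, and the arbitrary selection is followed on those alone; the law of play is then
    built explicitly from one uniform variable by nested intervals. Elsewhere the splitting is the
    greedy one, which has a closed measurable form. So play is greedy after the hitting time on
    every admissible history, not just almost surely. *)

Section words.

(** * Boolean words, the patterns of visits *)

Fixpoint words (n : nat) : seq (seq bool) :=
  if n is k.+1 then map (cons true) (words k) ++ map (cons false) (words k)
  else [:: [::]].

Lemma mem_words n w : (w \in words n) = (size w == n).
Proof.
elim: n w => [|n IH] [|b w] //=.
- by rewrite mem_cat; apply/norP; split; apply/mapP => -[].
- rewrite mem_cat; apply/orP/eqP => [[]/mapP[v vn [_ ->]]|[sw]].
  + by move: vn; rewrite IH => /eqP ->.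
  + by move: vn; rewrite IH => /eqP ->.
  + by case: b; [left|right]; apply: map_f; rewrite IH sw.
Qed.

Lemma uniq_words n : uniq (words n).
Proof.
elim: n => //= n IH; rewrite cat_uniq !map_inj_uniq ?IH /=; try by move=> x y [].
by rewrite andbT; apply/hasPn => _ /mapP[v _ ->]; apply/negP => /mapP[].
Qed.

Lemma big_words_cons (T : Type) (idx : T) (op : Monoid.com_law idx) n (g : seq bool -> T) :
  \big[op/idx]_(w <- words n.+1) g w =
  op (\big[op/idx]_(w <- words n) g (true :: w))
     (\big[op/idx]_(w <- words n) g (false :: w)).
Proof. by rewrite /= big_cat /= !big_map. Qed.

Lemma big_words_cons2 (T : Type) (idx : T) (op : Monoid.com_law idx) n (g : seq bool -> T) :
  \big[op/idx]_(w <- words n.+1) g w =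
  \big[op/idx]_(w <- words n) op (g (true :: w)) (g (false :: w)).
Proof. by rewrite big_words_cons big_split. Qed.

Lemma big_words_rcons (T : Type) (idx : T) (op : Monoid.com_law idx) n (g : seq bool -> T) :
  \big[op/idx]_(w <- words n.+1) g w =
  \big[op/idx]_(w <- words n) op (g (rcons w true)) (g (rcons w false)).
Proof.
elim: n g => [|n IH] g; first by rewrite big_words_cons !big_seq1.
rewrite big_words_cons (IH (fun w => g (true :: w))) (IH (fun w => g (false :: w))).
by rewrite [in RHS]big_words_cons.
Qed.

End words.

(** * Nonnegative vectors as unnormalised beliefs *)

Section vectors.
Context {R : realType} {Om : finType}.
Implicit Types (x y p q c : Om -> R) (t : R).

Definition nonneg x := forall w, 0 <= x w.
Definition mass x := \sum_w x w.

Lemma simplexE p : simplex p <-> nonneg p /\ mass p = 1.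
Proof. by []. Qed.

Lemma dotrD x y c : dotr (x \+ y) c = dotr x c + dotr y c.
Proof. by rewrite /dotr -big_split; apply: eq_bigr => w _; rewrite mulrDl. Qed.

Lemma dotrZ t x c : dotr (t \*o x) c = t * dotr x c.
Proof. by rewrite /dotr mulr_sumr; apply: eq_bigr => w _; rewrite mulrA. Qed.

Lemma dotr_ge0 x c : nonneg x -> nonneg c -> 0 <= dotr x c.
Proof. by move=> x0 c0; apply: sumr_ge0 => w _; rewrite mulr_ge0. Qed.

Lemma massE x : mass x = dotr x (fun=> 1).
Proof. by apply: eq_bigr => w _; rewrite mulr1. Qed.

Lemma massD x y : mass (x \+ y) = mass x + mass y.
Proof. by rewrite !massE dotrD. Qed.

Lemma massZ t x : mass (t \*o x) = t * mass x.
Proof. by rewrite !massE dotrZ. Qed.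

Lemma mass_ge0 x : nonneg x -> 0 <= mass x.
Proof. by move=> x0; apply: sumr_ge0. Qed.

Lemma le_mass x w : nonneg x -> x w <= mass x.
Proof. by move=> x0; rewrite /mass (bigD1 w) //= lerDl sumr_ge0. Qed.

Lemma mass_eq0 x : nonneg x -> mass x = 0 -> forall w, x w = 0.
Proof. by move=> x0 m0 w; apply/eqP; rewrite eq_le x0 -m0 le_mass. Qed.

Lemma nonnegD x y : nonneg x -> nonneg y -> nonneg (x \+ y).
Proof. by move=> x0 y0 w; rewrite /= addr_ge0. Qed.

Lemma nonnegZ t x : 0 <= t -> nonneg x -> nonneg (t \*o x).
Proof. by move=> t0 x0 w; rewrite /= mulr_ge0. Qed.

Lemma addBfun x p : x \+ (p \- x) = p.
Proof. by apply/funext => w /=; rewrite addrC subrK. Qed.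

End vectors.

(** * The belief transition on unnormalised vectors *)

Section transition.
Context {R : realType} {Om : finType} (m : Om -> R) (lam : R).
Hypothesis m_simplex : simplex m.
Hypothesis lam01 : 0 <= lam < 1.
Implicit Types (x y p q c : Om -> R) (t : R).

Local Notation phi := (phi (trans lam m)).

(** The factor [mass x] turns the affine map [m + lam (p - m)] of the simplex into a linear map on
    all vectors. *)
Lemma phiE x : phi x = lam \*o x \+ ((1 - lam) * mass x) \*o m.
Proof.
apply/funext => w' /=; rewrite /Defs.phi /trans (bigD1 w') //= eqxx.
rewrite (eq_bigr (fun w => x w * ((1 - lam) * m w'))); last first.
  by move=> w /negPf; rewrite eq_sym => ->.
rewrite -mulr_suml /mass [in RHS](bigD1 w') //=; ring.
Qed.

Lemma dotr_phi x c : dotr (phi x) c = lam * dotr x c + (1 - lam) * mass x * dotr m c.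
Proof. by rewrite phiE dotrD !dotrZ. Qed.

Lemma mass_phi x : mass (phi x) = mass x.
Proof.
by rewrite !massE dotr_phi -!massE; case: m_simplex => _; rewrite -/(mass m) => ->; ring.
Qed.

Lemma phiD x y : phi (x \+ y) = phi x \+ phi y.
Proof. by apply/funext => w; rewrite !phiE massD /=; ring. Qed.

Lemma phiZ t x : phi (t \*o x) = t \*o phi x.
Proof. by apply/funext => w; rewrite !phiE massZ /=; ring. Qed.

Lemma phi_ge0 x : nonneg x -> nonneg (phi x).
Proof.
have [m0 _] := m_simplex; have /andP[l0 l1] := lam01.
move=> x0; rewrite phiE; apply: nonnegD; apply: nonnegZ => //.
by rewrite mulr_ge0 ?mass_ge0// subr_ge0 ltW.
Qed.

Lemma phi_simplex x : simplex x -> simplex (phi x).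
Proof.
by move=> /simplexE[x0 x1]; apply/simplexE; split; [exact: phi_ge0|rewrite mass_phi].
Qed.

End transition.

(** * The one-stage problem: linear programming duality and the greedy knapsack *)

Section duality.
Context {R : realType} {Om : finType} (r : Om -> R).
Implicit Types (x y p q : Om -> R) (b : R).

(* The dual of the one-stage problem "maximise [mass x] over [0 <= x <= p] with
   [0 <= dotr x r]" is "minimise [dual b p] over [0 <= b]"; its minimum is
   attained at one of the kinks [breaks] of [b |-> dual b p]. *)
Definition weight b (w : Om) : R := Num.max 0 (1 + b * r w).
Definition dual b p := dotr p (weight b).
Definition breaks : seq R := 0 :: [seq - (r w)^-1 | w <- enum Om & r w < 0].

Lemma breaks_ge0 b : b \in breaks -> 0 <= b.
Proof.
rewrite inE => /orP[/eqP->//|/mapP[w]]; rewrite mem_filter => /andP[rw _] ->.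
by rewrite oppr_ge0 invr_le0 ltW.
Qed.

Lemma break0 : 0 \in breaks.
Proof. exact: mem_head. Qed.

Lemma weight_ge0 b : nonneg (weight b).
Proof. by move=> w; rewrite /weight le_max lexx. Qed.

Lemma dual_ge0 b p : nonneg p -> 0 <= dual b p.
Proof. by move=> p0; apply: dotr_ge0 => //; exact: weight_ge0. Qed.

Lemma dual0 p : dual 0 p = mass p.
Proof.
rewrite massE; apply: eq_bigr => w _.
by rewrite /weight mul0r addr0 (max_idPr ler01).
Qed.

Lemma mass_le_dual b x : 0 <= b -> nonneg x -> 0 <= dotr x r -> mass x <= dual b x.
Proof.
move=> b0 x0 xr; apply: (@le_trans _ _ (mass x + b * dotr x r)).
  by rewrite lerDl mulr_ge0.
rewrite /mass /dotr mulr_sumr -big_split; apply: ler_sum => w _ /=.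
rewrite mulrCA -{1}[x w]mulr1 -mulrDr; apply: ler_wpM2l => //.
by rewrite /weight le_max lexx orbT.
Qed.

(** Fractional knapsack filled in decreasing order of [r]: [above w p] is the payoff collected from
    all states strictly better than [w], and [level w p] is the cost of the states tied with [w].
    Ties are served in equal proportion, which keeps the solution explicit. A level of cost 0 with
    [r w < 0] carries no mass, so the division by 0 is harmless. *)
Definition above w p := \sum_(i | r w < r i) p i * r i.
Definition level w p := \sum_(i | r i == r w) p i * - r i.
Definition knapsack p w :=
  if 0 <= r w then p w
  else p w * Num.min 1 (Num.max 0 (above w p / level w p)).

Lemma knapsack_le p w : nonneg p -> knapsack p w <= p w.
Proof.
move=> p0; rewrite /knapsack; case: ifP => // _.
by rewrite ler_piMr // ge_min lexx.
Qed.

Lemma knapsack_ge0 p : nonneg p -> nonneg (knapsack p).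
Proof.
move=> p0 w; rewrite /knapsack; case: ifP => // _.
by rewrite mulr_ge0 // le_min ler01 le_max lexx.
Qed.

Lemma level_ge0 p w : nonneg p -> r w < 0 -> 0 <= level w p.
Proof.
move=> p0 rw; apply: sumr_ge0 => i /eqP ->.
by rewrite mulr_ge0 // oppr_ge0 ltW.
Qed.

Lemma level_eq0 p w : nonneg p -> r w < 0 -> level w p = 0 -> p w = 0.
Proof.
move=> p0 rw /eqP; rewrite /level psumr_eq0; last first.
  by move=> i /eqP ->; rewrite mulr_ge0 // oppr_ge0 ltW.
move=> /allP/(_ w (mem_index_enum w)); rewrite eqxx /= mulf_eq0 oppr_eq0.
by rewrite (lt_eqF rw) orbF => /eqP.
Qed.

Lemma knapsack_full p w : nonneg p -> r w < 0 -> level w p <= above w p ->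
  knapsack p w = p w.
Proof.
move=> p0 rw la; rewrite /knapsack leNgt rw /=.
have [l0|ln0] := eqVneq (level w p) 0; first by rewrite (level_eq0 p0 rw l0) mul0r.
have lp : 0 < level w p by rewrite lt_neqAle eq_sym ln0 level_ge0.
have h : 1 <= above w p / level w p by rewrite ler_pdivlMr // mul1r.
by rewrite (max_idPr (le_trans ler01 h)) (min_idPl h) mulr1.
Qed.

Definition at_least w p := \sum_(i | r w <= r i) p i * r i.

Lemma at_leastE w p : at_least w p = above w p - level w p.
Proof.
rewrite /at_least (bigID (fun i => r w < r i)) /=; congr (_ + _).
  by apply: eq_bigl => i; rewrite andb_idl // => /ltW.
rewrite /level -sumrN; apply: eq_big => [i|i _]; last by rewrite mulrN opprK.
by rewrite -leNgt eq_le andbC.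
Qed.

Lemma above_mono p v w : nonneg p -> r v < r w -> r w < 0 -> above v p <= at_least w p.
Proof.
move=> p0 vw w0; rewrite /above (bigID (fun i => r w <= r i)) /=.
rewrite /at_least (eq_bigl (fun i => r w <= r i)); last first.
  by move=> i; rewrite andb_idl // => /(lt_le_trans vw).
rewrite gerDl; apply: sumr_le0 => i /andP[_]; rewrite -ltNge => iw.
by rewrite mulr_ge0_le0 // ltW // (lt_trans iw).
Qed.

(* The marginal state: the best state at which the payoff constraint binds. *)
Lemma threshold_exists p : nonneg p -> dotr p r < 0 ->
  exists k, [/\ r k < 0, at_least k p < 0, 0 <= above k p
              & forall w, r k < r w -> r w < 0 -> 0 <= at_least w p].
Proof.
move=> p0 pr.
have [i0 pi0] : exists i, p i * r i < 0.
  apply/existsP; apply: contraLR pr => /existsPn h.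
  by rewrite -leNgt; apply: sumr_ge0 => i _; rewrite leNgt h.
have [l lmin] : exists l, forall w, r l <= r w.
  by case: (arg_minP r (erefl : xpredT i0)) => l _ lm; exists l => w; apply: lm.
have ri0 : r i0 < 0.
  rewrite ltNge; apply/negP => ri; move: pi0.
  by rewrite ltNge mulr_ge0.
have rl : r l < 0 by apply: le_lt_trans ri0.
have Ql : (r l < 0) && (at_least l p < 0).
  by rewrite rl /at_least (eq_bigl xpredT).
case: (@arg_maxP _ _ _ l (fun k => (r k < 0) && (at_least k p < 0)) r Ql).
move=> k /andP[rk bk] kmax; exists k; split => //; last first.
  move=> w kw w0; rewrite leNgt; apply/negP => bw.
  by have := kmax w; rewrite w0 bw => /(_ isT) /=; rewrite leNgt kw.
rewrite leNgt; apply/negP => ak.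
have [i1 ki1 pi1] : exists2 i, r k < r i & p i * r i < 0.
  have /existsP[i /andP[]] : [exists i, (r k < r i) && (p i * r i < 0)]; last by exists i.
  apply: contraLR ak => /existsPn h.
  by rewrite -leNgt; apply: sumr_ge0 => i ki; rewrite leNgt; have := h i; rewrite ki.
(* [v] lies on the next level above [k]. If [above k p] is negative, so is [at_least v p], against
   the maximality of [r k]. *)
case: (@arg_minP _ _ _ i1 (fun i => r k < r i) r ki1) => v kv vmin.
have ri1 : r i1 < 0.
  by rewrite ltNge; apply/negP => ri; move: pi1; rewrite ltNge mulr_ge0.
have rv : r v < 0 by apply: le_lt_trans ri1; apply: vmin.
have := kmax v; rewrite rv /=.
have -> : at_least v p = above k p.
  apply: eq_bigl => i; apply/idP/idP; first exact: lt_le_trans.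
  exact: vmin.
by rewrite ak => /(_ isT) /=; rewrite leNgt kv.
Qed.

Lemma knapsack_id p : nonneg p -> 0 <= dotr p r -> knapsack p = p.
Proof.
move=> p0 pr; apply/funext => w; have [rw|rw] := leP 0 (r w).
  by rewrite /knapsack rw.
apply: knapsack_full => //; rewrite -subr_ge0 -at_leastE (le_trans pr) //.
rewrite /dotr (bigID (fun i => r w <= r i)) /= gerDl.
apply: sumr_le0 => i; rewrite -ltNge => iw.
by rewrite mulr_ge0_le0 // ltW // (lt_trans iw).
Qed.

(** Strong duality by complementary slackness. If [p] itself has nonnegative payoff, all of it is
    taken and the multiplier is 0. Otherwise states better than the threshold [k] are taken whole,
    worse ones not at all, and the level of [k] in the fraction that makes the payoff exactly 0. *)
Lemma knapsack_dual p : nonneg p ->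
  0 <= dotr (knapsack p) r /\ exists2 b, b \in breaks & mass (knapsack p) = dual b p.
Proof.
move=> p0; have [pr|pr] := leP 0 (dotr p r).
  by rewrite knapsack_id //; split => //; exists 0; rewrite ?break0 ?dual0.
have [k [rk bk ak kmax]] := threshold_exists p0 pr.
have lk : above k p < level k p by rewrite -subr_lt0 -at_leastE.
have lk0 : 0 < level k p by apply: le_lt_trans lk.
have Kgt w : r k < r w -> knapsack p w = p w.
  move=> kw; have [rw|rw] := leP 0 (r w); first by rewrite /knapsack rw.
  by apply: knapsack_full => //; rewrite -subr_ge0 -at_leastE kmax.
have Keq w : r w = r k -> knapsack p w = p w * (above k p / level k p).
  move=> wk; rewrite /knapsack wk leNgt rk /= /above /level wk -/(above k p) -/(level k p).
  have h0 : 0 <= above k p / level k p by rewrite divr_ge0 // ltW.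
  have h1 : above k p / level k p <= 1 by rewrite ler_pdivrMr // mul1r ltW.
  by rewrite (max_idPr h0) (min_idPr h1).
have Klt w : r w < r k -> knapsack p w = 0.
  move=> wk; have rw := lt_trans wk rk; rewrite /knapsack leNgt rw /=.
  have aw : above w p <= 0 by apply: (le_trans (above_mono p0 wk rk)); exact: ltW.
  have h : above w p / level w p <= 0 by rewrite mulr_le0_ge0 // invr_ge0 level_ge0.
  by rewrite (max_idPl h) (min_idPr ler01) mulr0.
have dK : dotr (knapsack p) r = 0.
  rewrite /dotr (bigID (fun w => r k < r w)) /=.
  rewrite (eq_bigr (fun w => p w * r w)); last by move=> w /Kgt ->.
  rewrite -/(above k p) (bigID (fun w => r w == r k)) /= [X in _ + (_ + X)]big1; last first.
    move=> w /andP[]; rewrite -leNgt => wk nwk.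
    by rewrite Klt ?mul0r // lt_neqAle nwk.
  rewrite (eq_bigl (fun w => r w == r k)); last first.
    by move=> w; rewrite andb_idl // => /eqP ->; rewrite ltxx.
  rewrite (eq_bigr (fun w => - (above k p / level k p) * (p w * - r w))); last first.
    by move=> w /eqP /Keq ->; ring.
  by rewrite -mulr_sumr -/(level k p) addr0 mulNr divfK ?subrr // gt_eqF.
(* At this multiplier [1 + b * r w] is 0 on the level of [k], positive above it and negative below,
   so [weight b] is supported where the knapsack takes everything. *)
rewrite dK; split => //; exists (- (r k)^-1).
  by rewrite inE; apply/orP; right; apply/mapP; exists k => //; rewrite mem_filter /= rk mem_enum.
have -> : mass (knapsack p) = mass (knapsack p) + - (r k)^-1 * dotr (knapsack p) r.
  by rewrite dK mulr0 addr0.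
rewrite /mass /dotr /dual /dotr mulr_sumr -big_split; apply: eq_bigr => w _ /=.
have -> : knapsack p w + - (r k)^-1 * (knapsack p w * r w)
        = knapsack p w * (1 + - (r k)^-1 * r w) by ring.
have E : 1 + - (r k)^-1 * r w = (r k - r w) / r k by field; exact: ltr0_neq0.
rewrite /weight E; have [kw|wk|kw] := ltgtP (r k) (r w).
- rewrite Kgt // (max_idPr _) // mulr_le0 //; first by rewrite subr_le0 ltW.
  by rewrite invr_le0 ltW.
- rewrite Klt // mul0r (max_idPl _) ?mulr0 // mulr_ge0_le0 ?invr_le0 ?(ltW rk) //.
  by rewrite subr_ge0 ltW.
- by rewrite kw subrr mul0r mulr0 (max_idPl _) ?mulr0.
Qed.

(* [cell b]: the beliefs at which the one-stage value is the linear form [dual b]. *)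
Definition cell b p := nonneg p /\ forall b', b' \in breaks -> dual b p <= dual b' p.

Lemma cellD b x y : cell b x -> cell b y -> cell b (x \+ y).
Proof.
move=> [x0 xb] [y0 yb]; split; first exact: nonnegD.
by move=> b' b'B; rewrite /dual !dotrD lerD //; [exact: xb|exact: yb].
Qed.

Lemma cellZ b t x : 0 <= t -> cell b x -> cell b (t \*o x).
Proof.
move=> t0 [x0 xb]; split; first exact: nonnegZ.
by move=> b' b'B; rewrite /dual !dotrZ ler_wpM2l //; exact: xb.
Qed.

Lemma mass_le_dual_split b x y : 0 <= b -> nonneg x -> nonneg y ->
  0 <= dotr x r -> mass x <= dual b (x \+ y).
Proof.
move=> b0 x0 y0 xr; rewrite /dual dotrD.
by rewrite (le_trans (mass_le_dual b0 x0 xr)) // lerDl dual_ge0.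
Qed.

Lemma knapsackB_ge0 p : nonneg p -> nonneg (p \- knapsack p).
Proof. by move=> p0 w; rewrite /= subr_ge0 knapsack_le. Qed.

Lemma mass_knapsack b p : b \in breaks -> cell b p -> mass (knapsack p) = dual b p.
Proof.
move=> bB [p0 pb]; have [xr [b' b'B xE]] := knapsack_dual p0.
apply/eqP; rewrite eq_le; apply/andP; split; last by rewrite xE pb.
rewrite -[p in dual b p](addBfun (knapsack p)); apply: mass_le_dual_split => //.
- exact: breaks_ge0.
- exact: knapsack_ge0.
- exact: knapsackB_ge0.
Qed.

(** [dual b] is additive over the two pieces, and weak duality already assigns all of it to the
    first: there it equals the mass, and on the rest it is 0. No [dual b'] can be smaller on either
    piece. *)
Lemma cell_knapsack b p : b \in breaks -> cell b p ->
  cell b (knapsack p) /\ cell b (p \- knapsack p).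
Proof.
move=> bB pC; have [p0 pb] := pC; have [xr _] := knapsack_dual p0.
have x0 := knapsack_ge0 p0; have y0 := knapsackB_ge0 p0.
have E : dual b (knapsack p) + dual b (p \- knapsack p) = mass (knapsack p).
  by rewrite (mass_knapsack bB pC) /dual -dotrD addBfun.
have xb : mass (knapsack p) <= dual b (knapsack p).
  by apply: mass_le_dual => //; exact: breaks_ge0.
have yb := dual_ge0 b y0.
split; split=> // b' b'B.
- have := mass_le_dual (breaks_ge0 b'B) x0 xr; lra.
- have := dual_ge0 b' y0; lra.
Qed.

End duality.

(** * Geometric errors and compactness of product boxes *)

Section compactness.
Context {R : realType}.

(** Removes the error left by truncating at horizon [N]; used with [d] equal to [delta] for payoffs
    and to [lam] for hitting probabilities. *)
Lemma le_geometric (d u v K : R) : 0 <= d < 1 ->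
  (forall N, u <= v + d ^+ N * K) -> u <= v.
Proof.
move=> /andP[d0 d1] h; apply/ler_addgt0Pr => e e0.
have [N hNe] : exists N, d ^+ N * K <= e.
  have : (fun N => d ^+ N * K) @ \oo --> (0 * K).
    by apply: cvgMl; apply: cvg_expr; rewrite ger0_norm.
  rewrite mul0r => /cvgrPdist_le/(_ e e0)[N _ /(_ N (leqnn N))].
  by rewrite sub0r normrN => hN; exists N; exact: le_trans (ler_norm _) hN.
by apply: (le_trans (h N)); rewrite lerD2l.
Qed.

(** Tychonoff yields a cluster point, which is enough: every continuous inequality that holds from
    some index on passes to it, with no subsequence to extract. *)
Lemma box_limit (I : eqType) (c : R) (z : nat -> I -> R) :
  (forall k i, 0 <= z k i <= c) ->
  exists zz : I -> R, forall (h : {ptws I -> R} -> R) (a : R) (k0 : nat),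
    continuous h -> (forall k, (k0 <= k)%N -> a <= h (z k)) -> a <= h zz.
Proof.
move=> zc.
pose B := [set f : {ptws I -> R} | forall i, [set` `[0, c]] (f i)].
have cB : compact B.
  by apply: (@tychonoff I (fun=> R) (fun=> [set` `[0, c]])) => i; exact: segment_compact.
have zB : (z @ \oo) B.
  by exists 0%N => // k _ i /=; rewrite in_itv /= zc.
have [zz [_ czz]] := cB _ _ zB.
exists zz => h a k0 ch hz.
have cl : closed (h @^-1` [set y | a <= y]).
  by apply: closed_comp => [x _|]; [exact: ch|exact: closed_ge].
apply: cl; move=> N /czz; apply; exists k0 => //.
Qed.

Lemma ptws_continuous_sum (I : eqType) (J : Type) (s : seq J) (P : pred J)
    (h : J -> {ptws I -> R} -> R) :
  (forall j, P j -> continuous (h j)) ->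
  continuous (fun z => \sum_(j <- s | P j) h j z).
Proof.
move=> ch; elim: s => [|j s IH].
  have -> : (fun z => \sum_(j <- [::] | P j) h j z) = (fun=> 0).
    by apply/funext => z; rewrite big_nil.
  exact: cst_continuous.
have -> : (fun z => \sum_(j <- j :: s | P j) h j z) =
    (fun z => (if P j then h j z else 0) + \sum_(j <- s | P j) h j z).
  by apply/funext => z; rewrite big_cons; case: ifP => //; rewrite add0r.
move=> z; apply: continuousD; last exact: IH.
by case: (P j) (ch j) => [/(_ isT) chj|_]; [exact: chj|exact: cst_continuous].
Qed.

Lemma ptws_continuous_coord (I : eqType) (i : I) :
  continuous (fun z : {ptws I -> R} => z i).
Proof. exact: (@proj_continuous I (fun=> R) i). Qed.

Lemma ptws_continuousM (I : eqType) (c : R) (h : {ptws I -> R} -> R) :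
  continuous h -> continuous (fun z => c * h z).
Proof. by move=> ch z; apply: continuousM; [exact: cst_continuous|exact: ch]. Qed.

Lemma ptws_continuousDr (I : eqType) (c : R) (h : {ptws I -> R} -> R) :
  continuous h -> continuous (fun z => h z + c).
Proof. by move=> ch z; apply: continuousD; [exact: ch|exact: cst_continuous]. Qed.

End compactness.

(** * The linear program over trees and Bellman's equation *)

Section trees.
Context {R : realType} {Om : finType} (m : Om -> R) (lam : R) (r : Om -> R) (delta : R).
Hypothesis m_simplex : simplex m.
Hypothesis lam01 : 0 <= lam < 1.
Hypothesis delta01 : 0 <= delta < 1.
Implicit Types (x y p q : Om -> R) (Z : seq bool -> bool -> Om -> R).

Local Notation phi := (phi (trans lam m)).

(* [Z w b] is the law of the posterior, as a sub-probability vector, after the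
   pattern [w] of visits to [I] (first visit first) followed by [b]. *)
Definition tree p Z :=
  [/\ forall w b, nonneg (Z w b),
      forall w, 0 <= dotr (Z w true) r,
      Z [::] true \+ Z [::] false = p
    & forall w b, Z (rcons w b) true \+ Z (rcons w b) false = phi (Z w b)].

Definition tree_payoff N Z :=
  \sum_(n < N) (1 - delta) * delta ^+ n * \sum_(w <- words n) mass (Z w true).

Definition subtree b Z := fun w => Z (b :: w).

Definition join x y Z1 Z2 : seq bool -> bool -> Om -> R := fun w b =>
  if w is c :: v then (if c then Z1 v b else Z2 v b) else (if b then x else y).

Lemma tree_sub p Z b : tree p Z -> tree (phi (Z [::] b)) (subtree b Z).
Proof.
by case=> Z0 Zr _ Zs; split=> *; rewrite /subtree ?Z0 ?Zr // -?rcons_cons // -(Zs [::]).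
Qed.

Lemma tree_join x y Z1 Z2 : nonneg x -> nonneg y -> 0 <= dotr x r ->
  tree (phi x) Z1 -> tree (phi y) Z2 -> tree (x \+ y) (join x y Z1 Z2).
Proof.
move=> x0 y0 xr [Z10 Z1r Z1p Z1s] [Z20 Z2r Z2p Z2s]; split=> //.
- by move=> [|[] w] [] /=.
- by move=> [|[] w] /=.
- by move=> [|[] w] [] //=; rewrite ?Z1s ?Z2s.
Qed.

Lemma tree_payoffS N Z : tree_payoff N.+1 Z =
  (1 - delta) * mass (Z [::] true) +
  delta * (tree_payoff N (subtree true Z) + tree_payoff N (subtree false Z)).
Proof.
rewrite /tree_payoff big_ord_recl /= big_seq1 expr0 mulr1; congr (_ + _).
rewrite -big_split /= mulr_sumr; apply: eq_bigr => n _.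
by rewrite /bump /= add1n big_words_cons /= exprS /subtree; ring.
Qed.

Lemma delta_ge0 : 0 <= delta. Proof. by case/andP: delta01. Qed.
Lemma onem_delta_gt0 : 0 < 1 - delta. Proof. by rewrite subr_gt0; case/andP: delta01. Qed.

Lemma tree_payoff_mono N N' Z p : tree p Z -> (N <= N')%N ->
  tree_payoff N Z <= tree_payoff N' Z.
Proof.
move=> [Z0 _ _ _] /subnK <-; elim: (N' - N)%N => // k IH.
rewrite addSn (le_trans IH) // /tree_payoff big_ord_recr /= lerDl.
rewrite !mulr_ge0 ?exprn_ge0 ?delta_ge0 ?(ltW onem_delta_gt0) //.
by apply: sumr_ge0 => w _; apply: mass_ge0.
Qed.

Lemma tree_mass p Z : tree p Z -> mass (Z [::] true) + mass (Z [::] false) = mass p.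
Proof. by case=> _ _ <- _; rewrite massD. Qed.

(** [phi] preserves mass and the stage weights from [N] on sum to at most [delta ^+ N]. *)
Lemma tree_payoff_ub N N' p Z : tree p Z ->
  tree_payoff N' Z <= tree_payoff N Z + delta ^+ N * mass p.
Proof.
move=> Zp; have [NN'|/ltnW NN'] := leqP N' N.
  rewrite (le_trans (tree_payoff_mono Zp NN')) // lerDl mulr_ge0 ?exprn_ge0 ?delta_ge0 //.
  by case: Zp => Z0 _ <- _; apply/mass_ge0/nonnegD.
have d0 := delta_ge0; have d1 := onem_delta_gt0.
have ub M p' Z' : tree p' Z' -> tree_payoff M Z' <= mass p'.
  elim: M p' Z' => [|M IH] p' Z' tZ.
    by rewrite /tree_payoff big_ord0; case: tZ => Z0 _ <- _; apply/mass_ge0/nonnegD.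
  rewrite tree_payoffS; have E := tree_mass tZ.
  have h1 := IH _ _ (tree_sub true tZ); have h2 := IH _ _ (tree_sub false tZ).
  rewrite !mass_phi // in h1 h2.
  have h3 : 0 <= mass (Z' [::] false) by case: tZ => Z0 _ _ _; exact: mass_ge0.
  have h4 := ler_wpM2l d0 (lerD h1 h2).
  have h5 : 0 <= (1 - delta) * mass (Z' [::] false) by rewrite mulr_ge0 // ltW.
  by rewrite -E; apply: (le_trans (lerD (lexx _) h4)); lra.
elim: N N' p Z Zp NN' => [|N IH] N' p Z Zp.
  by rewrite [X in _ <= X + _]/tree_payoff big_ord0 add0r mul1r => _; exact: ub.
case: N' => // N'; rewrite ltnS => NN'; rewrite !tree_payoffS -(tree_mass Zp).
have h1 := IH _ _ _ (tree_sub true Zp) NN'; have h2 := IH _ _ _ (tree_sub false Zp) NN'.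
rewrite !mass_phi // in h1 h2.
have h4 := ler_wpM2l d0 (lerD h1 h2).
by rewrite -addrA lerD2l; apply: (le_trans h4); rewrite exprS; lra.
Qed.

(** Says that the infinite-horizon payoff of [Z] is at least [v] without a series: partial payoffs
    increase, and the tail past [N] is at most [delta ^+ N * mass p]. *)
Definition achieves p v :=
  exists2 Z, tree p Z & forall N, v <= tree_payoff N Z + delta ^+ N * mass p.

Definition val p := sup [set v | achieves p v].

Lemma achieves_payoff p Z N : tree p Z -> achieves p (tree_payoff N Z).
Proof. by move=> Zp; exists Z => // N'; exact: tree_payoff_ub. Qed.

Lemma achieves_ub p v : achieves p v -> v <= mass p.
Proof.
by move=> [Z Zp /(_ 0%N)]; rewrite /tree_payoff big_ord0 add0r mul1r.
Qed.

Lemma tree_exists p : nonneg p -> exists Z, tree p Z.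
Proof.
(* All mass goes to the unconstrained branch [false], and everything below a visit to [I] is 0. *)
move=> p0; exists (fun w b => if b || has id w then (fun=> 0) else iter (size w) phi p).
have it0 k : nonneg (iter k phi p) by elim: k => //= k IH; exact: phi_ge0.
split.
- by move=> w b; case: ifP => // _ j.
- by move=> w /=; apply: sumr_ge0 => j _; rewrite mul0r.
- by apply/funext => j /=; rewrite add0r.
- move=> w b; apply/funext => j /=; rewrite has_rcons size_rcons /= add0r.
  case: ifP => // _; rewrite phiE /= /mass big1 //; ring.
Qed.

Lemma achieves0 p : nonneg p -> achieves p 0.
Proof.
move=> /tree_exists[Z Zp]; have := achieves_payoff 0 Zp.
by rewrite /tree_payoff big_ord0.
Qed.

Lemma achieves_le_val p v : achieves p v -> v <= val p.
Proof.
move=> av; apply: ub_le_sup => //; exists (mass p) => u /= /achieves_ub; exact.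
Qed.

Lemma val_ge0 p : nonneg p -> 0 <= val p.
Proof. by move=> p0; apply/achieves_le_val/achieves0. Qed.

Lemma val_le_mass p : nonneg p -> val p <= mass p.
Proof.
move=> p0; apply: ge_sup; first by exists 0; exact: achieves0.
by move=> u /= /achieves_ub.
Qed.

Lemma tree_bound p Z w b : nonneg p -> tree p Z -> mass (Z w b) <= mass p.
Proof.
move=> p0 [Z0 _ Zp Zs].
have le2 x y q : nonneg x -> nonneg y -> x \+ y = q -> mass x <= mass q /\ mass y <= mass q.
  by move=> x0 y0 <-; rewrite massD lerDl lerDr !mass_ge0.
have aux c x y q : nonneg x -> nonneg y -> x \+ y = q -> mass (if c then x else y) <= mass q.
  by move=> x0 y0 /le2[]//; case: c.
elim/last_ind: w b => [|w c IH] b.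
  have := @aux b _ _ _ (Z0 [::] true) (Z0 [::] false) Zp; by case: b.
have := @aux b _ _ _ (Z0 (rcons w c) true) (Z0 (rcons w c) false) (Zs w c).
by rewrite mass_phi // => h; apply: le_trans (IH c); case: b h.
Qed.

(** Trees become functions on a single index set, so that the product topology applies. *)
Let unpack (z : seq bool * bool * Om -> R) : seq bool -> bool -> Om -> R :=
  fun w b j => z (w, b, j).

Let coord_cont w b j : continuous (fun z : {ptws seq bool * bool * Om -> R} => unpack z w b j).
Proof. exact: ptws_continuous_coord. Qed.

Let dotr_cont w b (c : Om -> R) : continuous (fun z : {ptws seq bool * bool * Om -> R} => dotr (unpack z w b) c).
Proof.
rewrite /dotr; apply: ptws_continuous_sum => j _.
have -> : (fun z : {ptws seq bool * bool * Om -> R} => unpack z w b j * c j) =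
    (fun z => c j * unpack z w b j) by apply/funext => z; rewrite mulrC.
by apply: ptws_continuousM; exact: coord_cont.
Qed.

Let mass_cont w b : continuous (fun z : {ptws seq bool * bool * Om -> R} => mass (unpack z w b)).
Proof. by rewrite /mass; apply: ptws_continuous_sum => j _; exact: coord_cont. Qed.

(** Coordinates of nearly optimal trees lie in [[0, mass p]]. Each single tree condition and each
    partial payoff involves finitely many coordinates, so all of them pass to a cluster point. *)
Lemma achieves_val p : nonneg p -> achieves p (val p).
Proof.
move=> p0.
have hs : has_sup [set v | achieves p v].
  by split; [exists 0; exact: achieves0|exists (mass p) => u /= /achieves_ub].
have /choice[Z hZ] : forall k : nat, exists Z, tree p Z /\
    forall N, val p - k.+1%:R^-1 <= tree_payoff N Z + delta ^+ N * mass p.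
  move=> k.
  have e0 : (0 : R) < k.+1%:R^-1 by rewrite invr_gt0 ltr0n.
  have [v [Z Zp hZ] vv] := sup_adherent e0 hs.
  by exists Z; split => // N; rewrite (le_trans (ltW vv)).
pose z k : seq bool * bool * Om -> R := fun i => Z k i.1.1 i.1.2 i.2.
have zc k i : 0 <= z k i <= mass p.
  have [tZ _] := hZ k; have [Z0 _ _ _] := tZ.
  by rewrite Z0 /= (le_trans (le_mass _ (Z0 _ _))) // (tree_bound _ _ p0 tZ).
have [zz lim] := box_limit zc.
have Zz k : unpack (z k) = Z k by [].
have limeq (h1 h2 : {ptws seq bool * bool * Om -> R} -> R) :
    continuous h1 -> continuous h2 -> (forall k, h1 (z k) = h2 (z k)) -> h1 zz = h2 zz.
  move=> c1 c2 E; apply/eqP; rewrite eq_le -subr_ge0 -[X in _ && X]subr_ge0.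
  by apply/andP; split; [apply: (lim (fun z => h2 z - h1 z) 0 0%N)|
     apply: (lim (fun z => h1 z - h2 z) 0 0%N)]; rewrite ?E ?subrr //;
     by [move=> u; apply: continuousB; [exact: c2|exact: c1] |
         move=> u; apply: continuousB; [exact: c1|exact: c2] |
         move=> k _; rewrite E subrr].
exists (unpack zz); first split.
- move=> w b j; apply: (lim (fun z => unpack z w b j) 0 0%N) => [|k _].
    exact: coord_cont.
  by rewrite Zz; have [[Z0 _ _ _] _] := hZ k; exact: Z0.
- move=> w; apply: (lim (fun z => dotr (unpack z w true) r) 0 0%N) => [|k _].
    exact: dotr_cont.
  by rewrite Zz; have [[_ Zr _ _] _] := hZ k; exact: Zr.
- apply/funext => j; apply: (limeq (fun z => unpack z [::] true j + unpack z [::] false j) (fun=> p j)).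
  + by move=> u; apply: continuousD; exact: coord_cont.
  + exact: cst_continuous.
  + by move=> k; rewrite Zz; have [[_ _ <- _] _] := hZ k.
- move=> w b; apply/funext => j.
  apply: (limeq (fun z => unpack z (rcons w b) true j + unpack z (rcons w b) false j)
                (fun z => phi (unpack z w b) j)).
  + by move=> u; apply: continuousD; exact: coord_cont.
  + exact: dotr_cont.
  + by move=> k; rewrite Zz; have [[_ _ _ <-] _] := hZ k.
- move=> N; apply/ler_addgt0Pr => e e0.
  have [k0 _ hk0] : \forall k \near \oo, k.+1%:R^-1 < e by exact: near_infty_natSinv_lt (PosNum e0).
  rewrite -lerBlDr.
  apply: (lim (fun z => tree_payoff N (unpack z) + delta ^+ N * mass p) (val p - e) k0).
    have cp : continuous (fun z : {ptws seq bool * bool * Om -> R} => tree_payoff N (unpack z)).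
      rewrite /tree_payoff; apply: ptws_continuous_sum => n _; apply: ptws_continuousM.
      by apply: ptws_continuous_sum => w _; exact: mass_cont.
    exact: (ptws_continuousDr cp).
  move=> k kk0; rewrite Zz; have [_ hN] := hZ k; apply: le_trans (hN N).
  by rewrite lerD2l lerN2 ltW //; exact: hk0.
Qed.

Lemma achieves_join x y v1 v2 : nonneg x -> nonneg y -> 0 <= dotr x r ->
  achieves (phi x) v1 -> achieves (phi y) v2 ->
  achieves (x \+ y) ((1 - delta) * mass x + delta * (v1 + v2)).
Proof.
move=> x0 y0 xr [Z1 t1 h1] [Z2 t2 h2].
have tj := tree_join x0 y0 xr t1 t2.
exists (join x y Z1 Z2) => // N.
(* The join uses up one stage, so horizon [M] of the subtrees gives horizon [M.+1]; horizon 0 then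
   follows from horizon 1. *)
suff h M : (1 - delta) * mass x + delta * (v1 + v2) <=
    tree_payoff M.+1 (join x y Z1 Z2) + delta ^+ M.+1 * mass (x \+ y).
  case: N => [|M]; last exact: h.
  apply: (le_trans (h 0%N)).
  rewrite tree_payoffS /= /tree_payoff !big_ord0 massD expr1 expr0.
  have := mass_ge0 y0; have := mass_ge0 x0; have d0 := onem_delta_gt0.
  move=> mx my; have : 0 <= (1 - delta) * mass y by rewrite mulr_ge0 // ltW.
  lra.
rewrite tree_payoffS /= -addrA lerD2l.
have := lerD (h1 M) (h2 M); rewrite !mass_phi // => /(ler_wpM2l delta_ge0) h.
by apply: (le_trans h); rewrite massD exprS /subtree /=; lra.
Qed.

Lemma achieves_split p v : nonneg p -> achieves p v ->
  exists x y, [/\ nonneg x, nonneg y, 0 <= dotr x r, x \+ y = p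
    & v <= (1 - delta) * mass x + delta * (val (phi x) + val (phi y))].
Proof.
move=> p0 [Z tZ hZ]; have [Z0 Zr Zp _] := tZ.
exists (Z [::] true), (Z [::] false); split => //.
have sub b M : val (phi (Z [::] b)) >= tree_payoff M (subtree b Z).
  by apply/achieves_le_val/achieves_payoff; exact: (tree_sub b tZ).
have d0 := delta_ge0.
have hN N : v <= (1 - delta) * mass (Z [::] true) +
    delta * (val (phi (Z [::] true)) + val (phi (Z [::] false))) + delta ^+ N * mass p.
  apply: (le_trans (hZ N.+1)); rewrite tree_payoffS -!addrA lerD2l; apply: lerD.
    by apply: ler_wpM2l => //; apply: lerD; exact: sub.
  rewrite exprS -mulrA ler_piMl //; last by case/andP: delta01 => _ /ltW.
  by rewrite mulr_ge0 ?exprn_ge0 ?mass_ge0.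
exact: (le_geometric delta01) hN.
Qed.

Lemma val_split x y : nonneg x -> nonneg y -> 0 <= dotr x r ->
  (1 - delta) * mass x + delta * (val (phi x) + val (phi y)) <= val (x \+ y).
Proof.
move=> x0 y0 xr; apply/achieves_le_val/achieves_join => //; apply/achieves_val/phi_ge0 => //.
Qed.

Lemma bellman p : nonneg p ->
  exists x, [/\ nonneg x, nonneg (p \- x), 0 <= dotr x r
    & val p = (1 - delta) * mass x + delta * (val (phi x) + val (phi (p \- x)))].
Proof.
move=> p0; have [x [y [x0 y0 xr xy h]]] := achieves_split p0 (achieves_val p0).
have yE : p \- x = y by rewrite -xy; apply/funext => w /=; rewrite addrAC subrr add0r.
exists x; rewrite yE; split => //; apply/eqP; rewrite eq_le h /= -xy.
exact: val_split.
Qed.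

Lemma tree_add p q Z1 Z2 : tree p Z1 -> tree q Z2 ->
  tree (p \+ q) (fun w b => Z1 w b \+ Z2 w b).
Proof.
move=> [Z10 Z1r Z1p Z1s] [Z20 Z2r Z2p Z2s]; split.
- by move=> w b; exact: nonnegD.
- by move=> w; rewrite dotrD addr_ge0.
- by rewrite -Z1p -Z2p; apply/funext => j /=; rewrite addrACA.
- by move=> w b; rewrite phiD -Z1s -Z2s; apply/funext => j /=; rewrite addrACA.
Qed.

(** Trees over [p] and over [q] add up nodewise to a tree over [p \+ q]. With [val_scale] this makes
    the value concave. *)
Lemma val_superadd p q : nonneg p -> nonneg q -> val p + val q <= val (p \+ q).
Proof.
move=> p0 q0; have [Z1 t1 h1] := achieves_val p0; have [Z2 t2 h2] := achieves_val q0.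
apply: achieves_le_val; exists (fun w b => Z1 w b \+ Z2 w b); first exact: tree_add.
move=> N; apply: (le_trans (lerD (h1 N) (h2 N))); rewrite massD mulrDr.
rewrite addrACA lerD2r /tree_payoff -big_split; apply: ler_sum => n _ /=.
rewrite -mulrDr -big_split /=.
by rewrite (eq_bigr (fun w => mass (Z1 w true \+ Z2 w true))) // => w _; rewrite massD.
Qed.

Lemma tree_scale t p Z : 0 <= t -> tree p Z -> tree (t \*o p) (fun w b => t \*o Z w b).
Proof.
move=> t0 [Z0 Zr Zp Zs]; split.
- by move=> w b; exact: nonnegZ.
- by move=> w; rewrite dotrZ mulr_ge0.
- by rewrite -Zp; apply/funext => j /=; rewrite mulrDr.
- by move=> w b; rewrite phiZ -Zs; apply/funext => j /=; rewrite mulrDr.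
Qed.

Lemma val_scale_ge t p : 0 <= t -> nonneg p -> t * val p <= val (t \*o p).
Proof.
move=> t0 p0; have [Z tZ h] := achieves_val p0.
apply: achieves_le_val; exists (fun w b => t \*o Z w b); first exact: tree_scale.
move=> N; apply: (le_trans (ler_wpM2l t0 (h N))); rewrite massZ mulrDr mulrCA lerD2r.
rewrite /tree_payoff mulr_sumr; apply: ler_sum => n _ /=.
rewrite mulrCA mulr_sumr.
by rewrite (eq_bigr (fun w => mass (t \*o Z w true))) // => w _; rewrite massZ.
Qed.

Lemma val_scale t p : 0 <= t -> nonneg p -> val (t \*o p) = t * val p.
Proof.
move=> t0 p0; apply/eqP; rewrite eq_le val_scale_ge // andbT.
have [->|tn0] := eqVneq t 0.
  rewrite mul0r (le_trans (val_le_mass _)) ?massZ ?mul0r //; exact: nonnegZ.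
have tp : 0 < t by rewrite lt_neqAle eq_sym tn0.
have := @val_scale_ge t^-1 (t \*o p); rewrite invr_ge0 t0 => /(_ isT (nonnegZ t0 p0)).
rewrite (_ : t^-1 \*o _ = p); last by apply/funext => j /=; rewrite mulKf.
by rewrite mulrC ler_pdivrMr // mulrC.
Qed.

End trees.

Section finite_minima.
Context {R : realType} {T : eqType}.

Lemma seq_argmin (f : T -> R) (s : seq T) (x : T) : x \in s ->
  exists2 b, b \in s & forall b', b' \in s -> f b <= f b'.
Proof.
elim: s x => // y [|z s] IH x _.
  by exists y; [exact: mem_head|move=> b'; rewrite inE => /eqP ->].
have [b bs bmin] := IH z (mem_head _ _).
have [yb|/ltW yb] := leP (f y) (f b).
  exists y; first exact: mem_head.
  by move=> b'; rewrite inE => /orP[/eqP->//|/bmin]; exact: le_trans.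
exists b; first by rewrite inE bs orbT.
by move=> b'; rewrite inE => /orP[/eqP->//|/bmin].
Qed.

Lemma seq_gap (f : T -> R) (P : T -> Prop) (s : seq T) :
  (forall b, b \in s -> P b -> 0 < f b) ->
  exists2 g, 0 < g & forall b, b \in s -> P b -> g <= f b.
Proof.
elim: s => [|y s IH] h; first by exists 1.
have [|g g0 hg] := IH; first by move=> b bs; apply: h; rewrite inE bs orbT.
have [Py|nPy] := pselect (P y).
  exists (Num.min (f y) g); first by rewrite lt_min g0 h // mem_head.
  move=> b; rewrite inE => /orP[/eqP -> _|bs Pb]; first by rewrite ge_min lexx.
  by rewrite ge_min hg ?orbT.
by exists g => // b; rewrite inE => /orP[/eqP ->|/hg//].
Qed.

End finite_minima.

(** * The value on the cones and the decay of the loss *)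

Section value_on_cells.
Context {R : realType} {Om : finType} (m : Om -> R) (lam : R) (r : Om -> R) (delta : R).
Hypothesis m_simplex : simplex m.
Hypothesis lam01 : 0 <= lam < 1.
Hypothesis delta01 : 0 <= delta < 1.
Implicit Types (x y p q : Om -> R) (b c : R).

Local Notation phi := (phi (trans lam m)).
Local Notation val := (val m lam r delta).
Local Notation tree := (tree m lam r).
Local Notation dual := (dual r).
Local Notation cell := (cell r).
Local Notation breaks := (breaks r).
Local Notation knapsack := (knapsack r).

(** The sum over [n] of [(1 - delta) * delta ^+ n * lam ^+ n]: the discounted weight with which the
    initial belief, rather than [m], enters the average beliefs. *)
Let kappa := (1 - delta) / (1 - delta * lam).

(* The payoff of collecting [dual b] of the average belief at every stage. *)
Definition lin b p := kappa * dual b p + (1 - kappa) * dual b m * mass p.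

Lemma linD b x y : lin b (x \+ y) = lin b x + lin b y.
Proof. by rewrite /lin /dual !dotrD massD; ring. Qed.

Lemma dual_phi b p : dual b (phi p) = lam * dual b p + (1 - lam) * mass p * dual b m.
Proof. exact: dotr_phi. Qed.

Lemma lin_phi b p : lin b (phi p) = lam * lin b p + (1 - lam) * mass p * lin b m.
Proof.
have m1 : mass m = 1 by case: m_simplex.
by rewrite /lin dual_phi mass_phi // m1; ring.
Qed.

Lemma onem_dl_neq0 : 1 - delta * lam != 0.
Proof.
have /andP[d0 d1] := delta01; have /andP[l0 l1] := lam01.
by rewrite subr_eq0 gt_eqF // mulr_ilt1.
Qed.

Lemma linE b p : lin b p = (1 - delta) * dual b p + delta * lin b (phi p).
Proof.
rewrite /lin dual_phi mass_phi // /kappa; field; exact: onem_dl_neq0.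
Qed.

Lemma kappa01 : 0 <= kappa <= 1.
Proof.
have /andP[d0 d1] := delta01; have /andP[l0 l1] := lam01.
have h : 0 < 1 - delta * lam by rewrite subr_gt0 mulr_ilt1.
apply/andP; split; first by rewrite divr_ge0 ?(ltW h) // subr_ge0 ltW.
by rewrite ler_pdivrMr // mul1r lerD2l lerN2 ler_piMr // ltW.
Qed.

Lemma lin_ge0 b p : nonneg p -> 0 <= lin b p.
Proof.
move=> p0; have /andP[k0 k1] := kappa01; have [m0 _] := m_simplex.
apply: addr_ge0; first by apply: mulr_ge0 => //; exact: dual_ge0.
apply: mulr_ge0; last exact: mass_ge0.
by apply: mulr_ge0; [rewrite subr_ge0|exact: dual_ge0].
Qed.

Lemma payoff_le_lin b N p Z : 0 <= b -> tree p Z -> tree_payoff delta N Z <= lin b p.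
Proof.
move=> b0; elim: N p Z => [|N IH] p Z tZ; have [Z0 Zr Zp _] := tZ.
  by rewrite /tree_payoff big_ord0 lin_ge0 // -Zp; exact: nonnegD.
rewrite tree_payoffS linE -[X in lin b (phi X)]Zp phiD linD.
have /andP[d0 d1] := delta01; apply: lerD.
  rewrite ler_wpM2l ?subr_ge0 ?(ltW d1) // -Zp.
  exact: mass_le_dual_split.
by apply: ler_wpM2l => //; apply: lerD; apply: IH;
  [exact: (tree_sub true tZ)|exact: (tree_sub false tZ)].
Qed.

Lemma val_le_lin b p : 0 <= b -> nonneg p -> val p <= lin b p.
Proof.
move=> b0 p0; have [Z tZ h] := achieves_val r m_simplex lam01 delta01 p0.
apply: (le_geometric delta01) => N.
by apply: (le_trans (h N)); apply: lerD => //; exact: payoff_le_lin.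
Qed.

Lemma cell_phi b x : cell b m -> cell b x -> cell b (phi x).
Proof.
have /andP[l0 l1] := lam01; move=> bm bx; rewrite phiE.
have [x0 _] := bx.
apply: cellD; apply: cellZ => //; rewrite mulr_ge0 ?mass_ge0 // subr_ge0 ltW //.
Qed.

Lemma val_ge_lin b p : b \in breaks -> cell b m -> cell b p -> lin b p <= val p.
Proof.
move=> bB bm bp; have /andP[d0 d1] := delta01; have /andP[k0 k1] := kappa01.
have m1 : mass m = 1 by case: m_simplex.
have step N q : cell b q -> lin b q <= val q + delta ^+ N * mass q.
  elim: N q => [|N IH] q bq; have [q0 qb] := bq.
    (* Base case: 0 is a kink and [dual 0] is the mass, so on a cell [dual b], and hence [lin b], is
       at most the mass. *)
    rewrite mul1r (le_trans _ (_ : mass q <= _)) //; last first.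
      by rewrite lerDr val_ge0.
    have h1 : dual b q <= mass q by rewrite -(dual0 r); apply: qb; exact: break0.
    have h2 : dual b m <= 1 by rewrite -m1 -(dual0 r); apply: bm.2; exact: break0.
    rewrite /lin.
    have h3 := ler_wpM2l k0 h1.
    have h4 : (1 - kappa) * dual b m * mass q <= (1 - kappa) * mass q.
      apply: ler_wpM2r; first exact: mass_ge0.
      by rewrite ler_piMr // subr_ge0.
    lra.
  have [bx by_] := cell_knapsack bB bq.
  have [xr _] := knapsack_dual r q0.
  have := val_split m_simplex lam01 delta01 (knapsack_ge0 r q0) (knapsackB_ge0 r q0) xr.
  rewrite addBfun (mass_knapsack bB bq) => hv.
  have := lerD (IH _ (cell_phi bm bx)) (IH _ (cell_phi bm by_)).
  rewrite -linD -phiD addBfun !mass_phi // => /(ler_wpM2l d0) hI.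
  rewrite linE; have mE : mass (knapsack q) + mass (q \- knapsack q) = mass q.
    by rewrite -massD addBfun.
  rewrite exprS -mE; lra.
by apply: (le_geometric delta01) => N; exact: step.
Qed.

Lemma val_cell b p : b \in breaks -> cell b m -> cell b p -> val p = lin b p.
Proof.
move=> bB bm bp; apply/eqP; rewrite eq_le val_ge_lin // andbT val_le_lin //.
  exact: breaks_ge0 bB.
by case: bp.
Qed.

(** Several cells qualify when different [dual b] are least at [m] together. *)
Definition core p := exists b, [/\ b \in breaks, cell b m & cell b p].

Lemma core_knapsack p : core p ->
  core (phi (knapsack p)) /\ core (phi (p \- knapsack p)).
Proof.
move=> [b [bB bm bp]]; have [bx by_] := cell_knapsack bB bp.
by split; exists b; split => //; exact: cell_phi.
Qed.

Lemma coreZ t p : 0 < t -> core (t \*o p) -> core p.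
Proof.
move=> t0 [b [bB bm bp]]; exists b; split => //.
have := @cellZ _ _ r b t^-1 _ _ bp; rewrite invr_ge0 ltW // => /(_ isT).
by rewrite (_ : _ \*o _ = p) //; apply/funext => j /=; rewrite mulKf // gt_eqF.
Qed.

Lemma bellman_core p : core p -> val p = (1 - delta) * mass (knapsack p)
  + delta * (val (phi (knapsack p)) + val (phi (p \- knapsack p))).
Proof.
move=> [b [bB bm bp]]; have [bx by_] := cell_knapsack bB bp.
rewrite !(val_cell bB bm) //; [|exact: cell_phi|exact: cell_phi].
by rewrite -linD -phiD addBfun (mass_knapsack bB bp) -linE.
Qed.

(* The slack [loss c] of the linear upper bound contracts by [lam] in
   expectation along optimal splittings. *)
Definition loss c p := lin c p - val p.

Lemma loss_ge0 c p : 0 <= c -> nonneg p -> 0 <= loss c p.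
Proof. by move=> c0 p0; rewrite subr_ge0 val_le_lin. Qed.

Lemma loss_scale c t p : 0 <= t -> nonneg p -> loss c (t \*o p) = t * loss c p.
Proof.
by move=> t0 p0; rewrite /loss (val_scale r m_simplex lam01) // /lin /dual dotrZ massZ; ring.
Qed.

Let zero : Om -> R := fun=> 0.

Let zero_ge0 : nonneg zero. Proof. by []. Qed.

Let addzero x : x \+ zero = x. Proof. by apply/funext => j /=; rewrite addr0. Qed.
Let zeroadd x : zero \+ x = x. Proof. by apply/funext => j /=; rewrite add0r. Qed.

(** Taken alone, [x] may be split into [x] and 0, and [y] into 0 and [y]. Hence the values of the
    pieces of an optimal splitting add up to at least the value of the whole, while [lin c] is
    additive. *)
Lemma loss_split c x y : nonneg x -> nonneg y -> 0 <= dotr x r ->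
  val (x \+ y) = (1 - delta) * mass x + delta * (val (phi x) + val (phi y)) ->
  loss c x + loss c y <= loss c (x \+ y).
Proof.
move=> x0 y0 xr E; have /andP[d0 d1] := delta01.
have z0 : 0 <= dotr zero r by rewrite /dotr big1 // => j _; rewrite mul0r.
have := val_split m_simplex lam01 delta01 x0 zero_ge0 xr.
have := val_split m_simplex lam01 delta01 zero_ge0 y0 z0.
have mz : mass zero = 0 by rewrite /mass big1.
have vz : 0 <= val (phi zero) by apply: val_ge0 => //; exact: phi_ge0.
rewrite addzero zeroadd mz /loss linD E => h1 h2.
have := mulr_ge0 d0 vz; lra.
Qed.

Lemma loss_phi c x : c \in breaks -> cell c m -> nonneg x ->
  loss c (phi x) <= lam * loss c x.
Proof.
move=> cB cm x0; have /andP[l0 l1] := lam01; have [m0 _] := m_simplex.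
have t0 : 0 <= (1 - lam) * mass x by rewrite mulr_ge0 ?mass_ge0 // subr_ge0 ltW.
have : lam * val x + (1 - lam) * mass x * lin c m <= val (phi x).
  rewrite phiE -(val_cell cB cm cm).
  rewrite -!(val_scale r m_simplex lam01) //.
  by apply: (val_superadd r m_simplex lam01); try exact: nonnegZ.
rewrite /loss lin_phi; lra.
Qed.

(** Only the first stage is compared: it pays at most [dual b p], where [lin c] counts [dual c p].
    The continuation is bounded by [lin c] itself. *)
Lemma loss_ge b c p : 0 <= b -> 0 <= c -> nonneg p ->
  (1 - delta) * (dual c p - dual b p) <= loss c p.
Proof.
move=> b0 c0 p0; have /andP[d0 d1] := delta01.
have [x [x0 y0 xr E]] := bellman r m_simplex lam01 delta01 p0.
rewrite /loss linE E -[X in lin c (phi X)](addBfun x) phiD linD.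
have h1 : mass x <= dual b p.
  by rewrite -(addBfun x p); exact: mass_le_dual_split.
have h1' := ler_wpM2l (_ : 0 <= 1 - delta) h1.
rewrite subr_ge0 ltW // in h1'; have {}h1' := h1' isT.
have h2 := val_le_lin c0 (phi_ge0 m_simplex lam01 x0).
have h3 := val_le_lin c0 (phi_ge0 m_simplex lam01 y0).
have := ler_wpM2l d0 (lerD h2 h3); lra.
Qed.

(** Let [dual b] be least at [phi q]. Its cell misses [m], so at [m] it exceeds [dual c] by at least
    [g]. To be the smaller one at [phi q], which mixes [q] and [m], it must be smaller at [q] by at
    least [(1 - lam) * g], and by [loss_ge] the first stage already loses [1 - delta] times that. *)
Lemma loss_gap c : c \in breaks -> cell c m ->
  exists2 eta, 0 < eta & forall q, simplex q -> ~ core (phi q) -> eta <= loss c q.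
Proof.
move=> cB cm; have /andP[d0 d1] := delta01; have /andP[l0 l1] := lam01.
have [|g g0 hg] := @seq_gap R R (fun b => dual b m - dual c m) (fun b => ~ cell b m) breaks.
  move=> b bB nbm; rewrite subr_gt0 ltNge; apply/negP => h; apply: nbm.
  split; first by case: m_simplex.
  by move=> b' b'B; apply: (le_trans h); exact: cm.2.
exists ((1 - delta) * ((1 - lam) * g)); first by rewrite !mulr_gt0 // subr_gt0.
move=> q /simplexE[q0 q1] nc.
have pq0 := phi_ge0 m_simplex lam01 q0.
have [b bB bmin] := seq_argmin (fun b => dual b (phi q)) (break0 r).
have nbm : ~ cell b m by move=> bm; apply: nc; exists b.
(* Otherwise [dual c] is least at [phi q] as well, which puts [phi q] in [cell c] and so in the
   core. *)
have lt_bc : dual b (phi q) < dual c (phi q).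
  rewrite ltNge; apply/negP => h; apply: nc; exists c; split => //; split => // b' b'B.
  by apply: (le_trans h); exact: bmin.
apply: le_trans (loss_ge (breaks_ge0 bB) (breaks_ge0 cB) q0).
rewrite ler_wpM2l ?subr_ge0 ?(ltW d1) //.
move: lt_bc; rewrite !dual_phi q1 !mulr1 => lt_bc.
have h1 : (1 - lam) * g <= (1 - lam) * (dual b m - dual c m).
  by rewrite ler_wpM2l ?hg // subr_ge0 ltW.
have h2 : (1 - lam) * g < lam * (dual c q - dual b q) by lra.
have h3 : 0 < dual c q - dual b q.
  have h4 : 0 < lam * (dual c q - dual b q).
    by apply: le_lt_trans h2; rewrite mulr_ge0 ?subr_ge0 ?ltW.
  by rewrite ltNge; apply/negP => h5; move: h4; rewrite ltNge mulr_ge0_le0.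
by apply: (le_trans (ltW h2)); rewrite ler_piMl // ltW.
Qed.

Lemma core_exists : exists c, c \in breaks /\ cell c m.
Proof.
have [c cB cmin] := seq_argmin (fun b => dual b m) (break0 r).
by exists c; split => //; split => //; case: m_simplex.
Qed.

(** The selection is made by choice and need not be measurable. Prescribing the knapsack on the core
    is compatible with optimality by [bellman_core]. *)
Lemma optimal_split_exists : exists f : (Om -> R) -> (Om -> R), forall p, nonneg p ->
  [/\ nonneg (f p), nonneg (p \- f p), 0 <= dotr (f p) r,
      val p = (1 - delta) * mass (f p) + delta * (val (phi (f p)) + val (phi (p \- f p)))
    & core p -> f p = knapsack p].
Proof.
suff /choice[f hf] : forall p, exists x, nonneg p ->
    [/\ nonneg x, nonneg (p \- x), 0 <= dotr x r,
        val p = (1 - delta) * mass x + delta * (val (phi x) + val (phi (p \- x)))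
      & core p -> x = knapsack p] by exists f.
move=> p; have [p0|np0] := pselect (nonneg p); last by exists p.
have [cp|ncp] := pselect (core p).
  exists (knapsack p) => _; split => //.
  - exact: knapsack_ge0.
  - exact: knapsackB_ge0.
  - by case: (knapsack_dual r p0).
  - exact: bellman_core.
by have [x [x0 y0 xr E]] := bellman r m_simplex lam01 delta01 p0; exists x => _; split.
Qed.

End value_on_cells.

(** * From unnormalised pieces to posteriors on the simplex *)

Section normalised_splitting.
Context {R : realType} {Om : finType} (r : Om -> R).
Implicit Types (x p : Om -> R).

(* A posterior drawn with probability 0 is set to the prior [p]. *)
Definition post_I x p : Om -> R := if mass x == 0 then p else (mass x)^-1 \*o x.
Definition post_J x p : Om -> R :=
  if 1 - mass x == 0 then p else (1 - mass x)^-1 \*o (p \- x).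

Variables (p x : Om -> R).
Hypotheses (p_simplex : simplex p) (x0 : nonneg x) (y0 : nonneg (p \- x)).

Let mass_rest : mass (p \- x) = 1 - mass x.
Proof.
by case: p_simplex => _ <-; rewrite -/(mass p) -[in RHS](addBfun x p) massD addrAC subrr add0r.
Qed.

Lemma mass_split01 : 0 <= mass x <= 1.
Proof. by rewrite mass_ge0 // -subr_ge0 -mass_rest mass_ge0. Qed.

Lemma post_IE : mass x \*o post_I x p = x.
Proof.
rewrite /post_I; apply/funext => j /=; have [m0|mn0] := eqVneq (mass x) 0.
  by rewrite m0 mul0r (mass_eq0 x0 m0).
by rewrite mulVKf.
Qed.

Lemma post_JE : (1 - mass x) \*o post_J x p = p \- x.
Proof.
rewrite /post_J; apply/funext => j /=; have [m1|mn1] := eqVneq (1 - mass x) 0.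
  by rewrite m1 mul0r -[RHS]/((p \- x) j) (mass_eq0 y0) // mass_rest.
by rewrite mulVKf.
Qed.

Lemma simplex_normalise (y : Om -> R) : nonneg y -> mass y != 0 ->
  simplex ((mass y)^-1 \*o y).
Proof.
move=> yge my; split; last by rewrite -/(mass _) massZ mulVf.
by apply: nonnegZ => //; rewrite invr_ge0 mass_ge0.
Qed.

Lemma post_I_simplex : simplex (post_I x p).
Proof. by rewrite /post_I; case: eqP => // /eqP mx; exact: simplex_normalise. Qed.

Lemma post_J_simplex : simplex (post_J x p).
Proof.
rewrite /post_J -mass_rest; case: eqP => // /eqP mx; exact: simplex_normalise.
Qed.

Lemma post_I_inI : 0 <= dotr x r -> mass x != 0 -> inI r (post_I x p).
Proof.
move=> xr mx; split; first exact: post_I_simplex.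
by rewrite /post_I (negPf mx) dotrZ mulr_ge0 // invr_ge0 mass_ge0.
Qed.

Lemma post_mean j : p j = mass x * post_I x p j + (1 - mass x) * post_J x p j.
Proof.
rewrite -[mass x * _]/((mass x \*o post_I x p) j) post_IE.
rewrite -[(1 - mass x) * _]/(((1 - mass x) \*o post_J x p) j) post_JE /=.
by rewrite addrC subrK.
Qed.

End normalised_splitting.

(** * Measurability on beliefs and on histories *)

Section measurability.
Context {R : realType} {Om : finType}.
Local Notation Belief := (Belief R Om).
Local Notation Path := (Path R Om).

Definition Hist n : measurableType _ :=
  g_sigma_algebraType (hist_gen n : set (set (pth R Om))).

Lemma measurable_coord w : measurable_fun setT (fun q : Belief => (q w : R)).
Proof.
by move=> _ B mB; rewrite setTI; apply: sub_sigma_algebra; exists w, B.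
Qed.

Lemma measurable_fun_Belief d (T : measurableType d) (f : T -> Belief) :
  (forall w, measurable_fun setT (fun t => (f t w : R))) -> measurable_fun setT f.
Proof.
move=> mf; apply: (@measurability _ _ T Belief setT f (@coord_gen R Om)) => // _ [_ [w [B [mB ->]]] <-].
exact: mf.
Qed.

Lemma measurable_stage k : measurable_fun setT (fun x : Path => (x k : Belief)).
Proof.
apply: measurable_fun_Belief => w _ B mB; rewrite setTI.
by apply: sub_sigma_algebra; exists k, w, B.
Qed.

Lemma measurable_stage_hist n k : (k < n)%N ->
  measurable_fun setT (fun x : Hist n => (x k : Belief)).
Proof.
move=> kn; apply: measurable_fun_Belief => w _ B mB; rewrite setTI.
by apply: sub_sigma_algebra; exists k, w, B.
Qed.

Lemma hist_sets_measurable n (A : set Path) : hist_sets n A -> measurable A.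
Proof.
apply: sub_sigma_algebra2 => _ [k [w [B [_ [mB ->]]]]]; by exists k, w, B.
Qed.

Lemma hist_sets_le n n' (A : set (nat -> Om -> R)) : (n <= n')%N ->
  hist_sets n A -> hist_sets n' A.
Proof.
move=> nn'; apply: sub_sigma_algebra2 => _ [k [w [B [kn [mB ->]]]]].
by exists k, w, B; split => //; exact: leq_trans nn'.
Qed.

Lemma hist_sets_stage n k (B : set Belief) : (k < n)%N -> measurable B ->
  hist_sets n [set x : nat -> Om -> R | B (x k)].
Proof.
by move=> kn mB; have := measurable_stage_hist kn measurableT mB; rewrite setTI.
Qed.

Lemma hist_setsI n (A B : set (nat -> Om -> R)) :
  hist_sets n A -> hist_sets n B -> hist_sets n (A `&` B).
Proof. by move=> mA mB; exact: (@measurableI _ (Hist n)). Qed.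

Lemma measurable_dotr (c : Om -> R) : measurable_fun setT (fun q : Belief => dotr q c).
Proof.
rewrite /dotr; apply: measurable_sum => w.
by apply: measurable_funM => //; exact: measurable_coord.
Qed.

Lemma measurable_mass : measurable_fun setT (fun q : Belief => mass q).
Proof. by apply: measurable_sum => w; exact: measurable_coord. Qed.

Lemma measurable_set_ge d (T : measurableType d) (f : T -> R) (a : R) :
  measurable_fun setT f -> measurable [set x | a <= f x].
Proof.
move=> mf; have := mf measurableT _ (measurable_itv `[a, +oo[).
rewrite setTI (_ : _ @^-1` _ = [set x | a <= f x]) //.
by apply/seteqP; split => x /=; rewrite in_itv /= andbT.
Qed.

Lemma measurable_inv : measurable_fun setT (fun x : R => x^-1).
Proof.
have -> : (fun x : R => x^-1) = (fun x => if x == 0 then 0 else x^-1).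
  by apply/funext => x; case: eqP => // ->; rewrite invr0.
apply: measurable_fun_if => //.
- by apply: measurable_fun_eqr.
- rewrite setTI; apply: open_continuous_measurable_fun.
    rewrite (_ : _ @^-1` _ = ~` [set 0]); first exact: closed_openC.
    by apply/seteqP; split => x /=; [move=> /eqP|move/eqP/negbTE].
  move=> x; rewrite inE /= => /negbT x0; exact: inv_continuous.
Qed.

Lemma measurable_invr d (T : measurableType d) (f : T -> R) :
  measurable_fun setT f -> measurable_fun setT (fun x => (f x)^-1).
Proof. exact: (measurableT_comp measurable_inv). Qed.

Lemma measurable_simplex : measurable (@simplex R Om : set Belief).
Proof.
have -> : (@simplex R Om : set Belief) =
    \bigcap_(w in setT) [set q : Belief | 0 <= q w] `&` (fun q => mass q) @^-1` [set 1].
  by apply/seteqP; split => q [q0 q1]; split => //; [move=> w _|move=> w]; exact: q0.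
apply: measurableI.
  apply: fin_bigcap_measurable => // w _; apply: measurable_set_ge.
  exact: measurable_coord.
by rewrite -[X in measurable X]setTI; apply: measurable_mass.
Qed.

Lemma measurable_inI r : measurable (inI r : set Belief).
Proof.
by apply: measurableI; [exact: measurable_simplex|
  apply: measurable_set_ge; exact: measurable_dotr].
Qed.

End measurability.

(** * Integrating functions of the posterior against the stage kernel *)

Section disintegration.
Local Open Scope ereal_scope.
Context d d' (X : measurableType d) (Y : measurableType d') (R : realType).
Variables (P : {measure set X -> \bar R}) (k : X -> probability Y R) (g : X -> Y).
Variables (A : set X).
Hypothesis mA : measurable A.
Hypothesis mg : measurable_fun setT g.
Hypothesis mk : forall B, measurable B -> measurable_fun setT (fun x => k x B).
Hypothesis Pk : forall B, measurable B ->
  P (A `&` g @^-1` B) = \int[P]_(x in A) k x B.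

Import HBNNSimple.

Let mgB B : measurable B -> measurable (g @^-1` B).
Proof. by move=> mB; rewrite -[_ @^-1` _]setTI; exact: mg. Qed.

Let disintegration_nnsfun (h : {nnsfun Y >-> R}) :
  \int[P]_(x in A) (h (g x))%:E = \int[P]_(x in A) \int[k x]_y (h y)%:E.
Proof.
have E r x : \1_(h @^-1` [set r]) (g x) = \1_(g @^-1` (h @^-1` [set r])) x :> R.
  by rewrite !indicE.
transitivity (\sum_(r \in range h) r%:E * P (A `&` g @^-1` (h @^-1` [set r]))).
  under eq_integral do rewrite fimfunE -fsumEFin//.
  rewrite ge0_integral_fsum//; last 2 first.
  - move=> r; apply/measurable_EFinP; apply: measurable_funM => //.
    under eq_fun do rewrite E.
    by apply: measurable_indic; exact: mgB.
  - by move=> r x _; rewrite EFinM nnfun_muleindic_ge0.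
  apply: eq_fsbigr => r _.
  under eq_integral do rewrite E.
  rewrite (integralZl_indic _ (fun r => g @^-1` (h @^-1` [set r])))//.
  - by rewrite integral_indic; [rewrite setIC|exact: mA|exact: mgB].
  - by move=> r0; rewrite preimage_nnfun0.
  - exact: mgB.
transitivity (\int[P]_(x in A) \sum_(r \in range h) (r%:E * k x (h @^-1` [set r]))).
  rewrite ge0_integral_fsum//; last 2 first.
  - move=> r; apply: measurable_funeM; apply: (@measurable_funS _ _ _ _ setT) => //.
    exact: mk.
  - by move=> r x _; exact: (@nnsfun_mulemu_ge0 _ _ _ (k x) h).
  apply: eq_fsbigr => r; rewrite inE => -[y _ <-].
  rewrite Pk // ge0_integralZl // ?lee_fin //.
  by apply: (@measurable_funS _ _ _ _ setT) => //; exact: mk.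
by apply: eq_integral => x _; rewrite integralT_nnsfun sintegralE.
Qed.

(** [Pk] is the case of indicators; linearity gives simple functions, and monotone convergence, in
    the inner and the outer integral, gives the rest. *)
Lemma disintegration (f : Y -> \bar R) :
  (forall y, 0 <= f y) -> measurable_fun setT f ->
  \int[P]_(x in A) f (g x) = \int[P]_(x in A) \int[k x]_y f y.
Proof.
move=> f0 mf; pose h := nnsfun_approx measurableT mf.
have mh n : measurable_fun setT (fun y => (h n y)%:E) by exact/measurable_EFinP.
have h0 n y : 0 <= (h n y)%:E by rewrite lee_fin.
have nd y n n' : (n <= n')%N -> (h n y)%:E <= (h n' y)%:E.
  by move=> nn'; rewrite lee_fin; exact/lefP/nd_nnsfun_approx.
have hf y : limn (fun n => (h n y)%:E) = f y.
  by apply/cvg_lim => //; exact: cvg_nnsfun_approx.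
transitivity (\int[P]_(x in A) limn (fun n => (h n (g x))%:E)).
  by apply: eq_integral => x _; rewrite hf.
rewrite monotone_convergence//; last 2 first.
- move=> n; apply: (@measurable_funS _ _ _ _ setT) => //.
  exact: (measurableT_comp (mh n)).
- by move=> x _ n n'; exact: nd.
transitivity (limn (fun n => \int[P]_(x in A) \int[k x]_y (h n y)%:E)).
  by apply: congr_lim; apply/funext => n; rewrite disintegration_nnsfun.
rewrite -monotone_convergence//; last 3 first.
- move=> n; apply: (@measurable_funS _ _ _ _ setT) => //.
  exact: measurable_fun_integral_kernel.
- by move=> n x _; exact: integral_ge0.
- by move=> x _ n n' nn'; apply: ge0_le_integral => // y _; exact: nd.
apply: eq_integral => x _; rewrite -monotone_convergence//.
  by apply: eq_integral => y _; rewrite hf.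
by move=> y _ n n'; exact: nd.
Qed.

End disintegration.

Lemma probability1_setI d (T : measurableType d) (R : realType) (P : probability T R)
    (A B : set T) : measurable A -> measurable B -> P A = 1%E -> P (B `&` A) = P B.
Proof.
move=> mA mB PA; rewrite -[in RHS](setIT B) -(setUv A) setIUr measureU.
- rewrite [X in (_ + X)%E](_ : _ = 0%E) ?adde0 //.
  apply: (@subset_measure0 _ _ _ P _ (~` A)) => //.
  + by apply: measurableI => //; exact: measurableC.
  + exact: measurableC.
  + by rewrite [LHS](probability_setC P mA) PA subee.
- exact: measurableI.
- by apply: measurableI => //; exact: measurableC.
- by rewrite setIACA setICr setI0.
Qed.

(** * The payoff as a series of visit probabilities *)

Section payoff_series.
Context {R : realType} {Om : finType} (r : Om -> R) (delta : R).
Hypothesis delta01 : 0 <= delta < 1.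
Local Notation Path := (Path R Om).

Lemma measurable_stage_I n : measurable [set x : Path | inI r (x n)].
Proof.
by have := measurable_stage (n) measurableT (measurable_inI r); rewrite setTI.
Qed.

Lemma measurable_stage_indic n :
  measurable_fun setT (fun x : Path => \1_(inI r) (x n) : R).
Proof.
have : measurable_fun setT (\1_[set x : Path | inI r (x n)] : Path -> R).
  by apply: measurable_indic; exact: measurable_stage_I.
by apply: eq_measurable_fun => x _; rewrite !indicE.
Qed.

Lemma payoffE (P : probability Path R) : payoff r delta P =
  (\sum_(0 <= n <oo) ((1 - delta) * delta ^+ n)%:E * P [set x : Path | inI r (x n)])%E.
Proof.
have /andP[d0 d1] := delta01.
have c0 n : 0 <= (1 - delta) * delta ^+ n by rewrite mulr_ge0 ?exprn_ge0 // subr_ge0 ltW.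
rewrite /payoff integral_nneseries //.
- apply: eq_eseriesr => n _.
  under eq_integral do rewrite EFinM.
  rewrite ge0_integralZl ?lee_fin //.
  + have E (x : Path) : (\1_(inI r) (x n))%:E = (\1_[set x : Path | inI r (x n)] x)%:E :> \bar R.
      by rewrite !indicE.
    under eq_integral do rewrite E.
    by rewrite integral_indic ?setIT //; exact: measurable_stage_I.
  + apply/measurable_EFinP.
    exact: measurable_stage_indic.
- move=> n; apply/measurable_EFinP; apply: measurable_funM => //.
  exact: measurable_stage_indic.
- by move=> n x _; rewrite lee_fin mulr_ge0 // indicE.
Qed.

End payoff_series.

(** * Every strategy is dominated by the linear program *)

Section upper_bound.
Context {R : realType} {Om : finType} (m : Om -> R) (lam : R) (r : Om -> R)
  (delta : R) (p1 : Om -> R).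
Hypothesis m_simplex : simplex m.
Hypothesis delta01 : 0 <= delta < 1.
Local Notation Path := (Path R Om).
Local Notation Belief := (Belief R Om).
Local Notation M := (trans lam m).
Variables (s : strategy R Om) (P : probability Path R).
Hypothesis s_ok : strategy_ok M p1 s.
Hypothesis s_law : induced_law s P.

Lemma hist_sets_ok n : hist_sets n [set x : nat -> Om -> R | hist_ok n x].
Proof.
have -> : [set x : nat -> Om -> R | hist_ok n x] =
    \bigcap_(k in `I_n) [set x | simplex (x k)].
  by apply/seteqP; split => x h k; exact: h.
apply: (@fin_bigcap_measurable _ (Hist n)) => // k kn.
by apply: hist_sets_stage => //; exact: measurable_simplex.
Qed.

Let s_meas n B : measurable B -> measurable_fun setT (fun x : Path => s n x B).
Proof.
move=> mB _ Y mY; rewrite setTI; apply: (@hist_sets_measurable _ _ n).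
by case: s_ok => _ [+ _]; apply.
Qed.

Let s_split n (x : Path) : hist_ok n x -> splitting (belief M p1 n x) (s n x).
Proof. by case: s_ok => _ [_]; apply. Qed.

Let disint n A (f : Belief -> \bar R) : hist_sets n A ->
  (forall q, 0 <= f q)%E -> measurable_fun setT f ->
  (\int[P]_(x in A) f (x n) = \int[P]_(x in A) \int[s n x]_q f q)%E.
Proof.
move=> hA f0 mf; apply: disintegration => //.
- exact: hist_sets_measurable hA.
- exact: measurable_stage.
- exact: s_meas.
- by move=> B mB; exact: s_law.
Qed.

Lemma hist_okS n (x : nat -> Om -> R) : hist_ok n.+1 x <-> hist_ok n x /\ simplex (x n).
Proof.
split=> [h|[h hn] k].
  by split=> [k kn|]; apply: h => //; exact: ltnW.
by rewrite ltnS leq_eqVlt => /orP[/eqP ->//|]; exact: h.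
Qed.

Lemma hist_ok_as n : P [set x : Path | hist_ok n x] = 1%E.
Proof.
elim: n => [|n IH].
  by rewrite (_ : [set x | _] = setT) ?probability_setT //; apply/seteqP; split.
rewrite (_ : [set x | _] = [set x : Path | hist_ok n x] `&` [set x : Path | simplex (x n)]).
  rewrite s_law; [|exact: hist_sets_ok|exact: measurable_simplex].
  transitivity (\int[P]_(x in [set x : Path | hist_ok n x]) (cst 1%E x))%E.
    apply: eq_integral => x; rewrite inE => hx.
    by have [-> _] := s_split hx.
  rewrite integral_cst ?mul1e //.
  by apply: (hist_sets_measurable (n := n)); exact: hist_sets_ok.
by apply/seteqP; split => x /hist_okS.
Qed.

Lemma stage_mean n (A : set Path) j : hist_sets n A ->
  (forall x, A x -> hist_ok n x) ->
  (\int[P]_(x in A `&` [set x : Path | simplex (x n)]) (x n j)%:E =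
   \int[P]_(x in A) (belief M p1 n x j)%:E)%E.
Proof.
move=> hA Aok; have mA := hist_sets_measurable hA.
have mS := @measurable_simplex R Om.
(* Cutting off outside the simplex makes the integrand nonnegative everywhere and changes it only on
   a null set of each [s n x] with [x] in [A]. *)
pose f (q : Belief) : \bar R := (q j * \1_(@simplex R Om : set Belief) q)%:E.
have f0 q : (0 <= f q)%E.
  rewrite lee_fin indicE; case: (boolP (q \in _)) => [|_]; last by rewrite mulr0.
  by rewrite inE => -[q0 _]; rewrite mulr1.
have mf : measurable_fun setT f.
  apply/measurable_EFinP; apply: measurable_funM; first exact: measurable_coord.
  exact: measurable_indic.
transitivity (\int[P]_(x in A) f (x n))%E.
  rewrite integral_mkcondr; apply: eq_integral => x _.
  by rewrite epatch_indic /f EFinM /= !indicE.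
rewrite disint //; apply: eq_integral => x; rewrite inE => Ax.
have [sS sm] := s_split (Aok _ Ax); rewrite -sm.
apply: ae_eq_integral => //.
  by apply/measurable_EFinP; exact: measurable_coord.
exists (~` (@simplex R Om)); split.
- exact: measurableC.
- by rewrite [LHS](probability_setC (s n x) mS) sS subee.
- move=> q /= h qS; apply: h => _; rewrite /f indicE mem_set // mulr1 //.
Qed.

Definition visits n (x : nat -> Om -> R) : seq bool := mkseq (fun k => `[< inI r (x k) >]) n.

(** Requiring [hist_ok] costs only a null set and bounds the coordinates of the posteriors, which
    makes them integrable on the event. *)
Definition visit_event (w : seq bool) : set Path :=
  [set x | hist_ok (size w) x /\ visits (size w) x = w].

Lemma visit_event_rcons w b : visit_event (rcons w b) = visit_event w `&`
  [set x : Path | simplex (x (size w))] `&` [set x : Path | `[< inI r (x (size w)) >] = b].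
Proof.
apply/seteqP; split => x; rewrite /visit_event /visits /= size_rcons.
  by move=> [/hist_okS[h1 h2]]; rewrite mkseqS => /rcons_inj[-> ->].
move=> [[[h1 hw] h2] <-]; split; first exact/hist_okS.
by rewrite mkseqS hw.
Qed.

Lemma hist_sets_visit_event w : hist_sets (size w) (visit_event w).
Proof.
elim/last_ind: w => [|w b IH].
  rewrite (_ : visit_event _ = setT); first exact: (@measurableT _ (Hist 0)).
  by apply/seteqP; split.
rewrite visit_event_rcons size_rcons; apply: hist_setsI; first apply: hist_setsI.
- exact: hist_sets_le IH.
- by apply: hist_sets_stage => //; exact: measurable_simplex.
- case: b.
    rewrite (_ : [set x | _] = [set x : nat -> Om -> R | inI r (x (size w))]).
      by apply: hist_sets_stage => //; exact: measurable_inI.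
    by apply/seteqP; split => x /=; [move/asboolP|move=> h; exact/asboolP].
  rewrite (_ : [set x | _] = [set x : nat -> Om -> R | (~` inI r) (x (size w))]).
    by apply: hist_sets_stage => //; apply: measurableC; exact: measurable_inI.
  by apply/seteqP; split => x /=; [move=> /negbT/asboolPn|move=> h; exact/negbTE/asboolPn].
Qed.

Lemma measurable_visit_event w : measurable (visit_event w).
Proof. by apply: (@hist_sets_measurable _ _ (size w)); exact: hist_sets_visit_event. Qed.

(** An integral and not a conditional mean: the mass of the vector is then the probability of the
    pattern, and patterns of probability 0 need no separate treatment. *)
Definition law_tree : seq bool -> bool -> Om -> R := fun w b j =>
  \int[P]_(x in visit_event (rcons w b)) (x (size w) j).

Lemma simplex_le1 (q : Om -> R) j : simplex q -> 0 <= q j <= 1.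
Proof. by move=> [q0 q1]; rewrite q0 -q1; exact: (le_mass j q0). Qed.

Lemma integrable_stage n j (A : set Path) : measurable A ->
  (forall x, A x -> simplex (x n)) -> P.-integrable A (EFin \o (fun x : Path => x n j)).
Proof.
move=> mA Asx; apply: measurable_bounded_integrable => //.
- by apply: (le_lt_trans (probability_le1 P mA)); rewrite ltry.
- apply: (@measurable_funS _ _ _ _ setT) => //.
  exact: (measurableT_comp (measurable_coord j) (measurable_stage n)).
- exists 1; split => // M M1 x Ax /=.
  have /andP[h0 h1] := simplex_le1 j (Asx _ Ax).
  by rewrite ger0_norm // (le_trans h1) // ltW.
Qed.

Let event_simplex w b x : visit_event (rcons w b) x -> simplex (x (size w)).
Proof. by rewrite visit_event_rcons => -[[_ ]]. Qed.

Lemma dotr_law_tree w b c :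
  dotr (law_tree w b) c = \int[P]_(x in visit_event (rcons w b)) dotr (x (size w)) c.
Proof.
have mW := measurable_visit_event (rcons w b).
have intw j : P.-integrable (visit_event (rcons w b))
    (fun x : Path => (x (size w) j)%:E).
  by apply: integrable_stage => // x; exact: event_simplex.
rewrite /dotr /Rintegral; under [in RHS]eq_integral do rewrite -sumEFin.
rewrite integral_sum //; last first.
  move=> j; under eq_fun do rewrite EFinM muleC.
  exact: integrableZl.
rewrite -sum_fine; last first.
  move=> j _; apply: integrable_fin_num => //; under eq_fun do rewrite EFinM muleC.
  exact: integrableZl.
by apply: eq_bigr => j _; rewrite /law_tree -RintegralZr //; exact: intw.
Qed.

Lemma law_tree_sum w j : law_tree w true j + law_tree w false j =
  \int[P]_(x in visit_event w) belief M p1 (size w) x j.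
Proof.
have mW b := measurable_visit_event (rcons w b).
have E : visit_event (rcons w true) `|` visit_event (rcons w false) =
    visit_event w `&` [set x : Path | simplex (x (size w))].
  rewrite !visit_event_rcons; apply/seteqP; split => [x [[]|[]]//|x h].
  by case E : `[< inI r (x (size w)) >]; [left|right].
rewrite /law_tree -Rintegral_setU //.
- rewrite E /Rintegral stage_mean //; first exact: hist_sets_visit_event.
  by move=> x [].
- apply: integrable_stage; first exact: measurableU.
  by rewrite E => x [].
- apply/disj_setPS => x; rewrite !visit_event_rcons.
  by move=> [[_ /= ->] [_ /=]].
Qed.

(** The tree conditions are linear in the posteriors and so survive averaging over a pattern; the
    two equations express that the posterior has the current belief as its mean. *)
Lemma law_tree_tree : tree m lam r p1 law_tree.
Proof.
split.
- by move=> w b j; apply: Rintegral_ge0 => x /event_simplex[]; exact.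
- move=> w; rewrite dotr_law_tree; apply: Rintegral_ge0 => x.
  by rewrite visit_event_rcons => -[_ /= /asboolP[]].
- apply/funext => j /=; rewrite law_tree_sum /=.
  rewrite (_ : visit_event [::] = setT); last by apply/seteqP; split.
  rewrite Rintegral_cst; last exact: measurableT.
  rewrite -[RHS]mulr1; congr (_ * _).
  exact: (congr1 fine (@probability_setT _ _ _ P)).
- move=> w b; apply/funext => j /=; rewrite law_tree_sum size_rcons /=.
  by rewrite /phi -/(dotr _ (fun w => M w j)) dotr_law_tree.
Qed.

Lemma visit_event_partition n (B : set Path) : measurable B ->
  (\sum_(w <- words n) P (visit_event w `&` B) = P ([set x : Path | hist_ok n x] `&` B))%E.
Proof.
elim: n B => [|n IH] B mB.
  rewrite big_seq1; congr (P (_ `&` _)); by apply/seteqP; split.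
have mS : measurable [set x : Path | simplex (x n)].
  by have := measurable_stage n measurableT (@measurable_simplex R Om); rewrite setTI.
rewrite big_words_rcons.
transitivity (\sum_(w <- words n) P (visit_event w `&` ([set x : Path | simplex (x n)] `&` B)))%E.
  apply: eq_big_seq => w; rewrite mem_words => /eqP sw.
  rewrite [LHS](_ : _ = P ((visit_event (rcons w true) `&` B) `|` (visit_event (rcons w false) `&` B)))%E.
    rewrite !visit_event_rcons sw; congr (P _); apply/seteqP; split.
      by move=> x [[[[h1 h2] _] h3]|[[[h1 h2] _] h3]].
    move=> x [h1 [h2 h3]].
    by case E : `[< inI r (x n) >]; [left|right].
  rewrite measureU //.
  - by apply: measurableI => //; exact: measurable_visit_event.
  - by apply: measurableI => //; exact: measurable_visit_event.
  - apply/seteqP; split => // x; rewrite !visit_event_rcons.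
    by move=> [[[_ /= ->] _] [[_ /=]]].
rewrite IH; last exact: measurableI.
by congr (P _); apply/seteqP; split => [x [h1 [h2 h3]]|x [/hist_okS[h1 h2] h3]];
  split => //; exact/hist_okS.
Qed.

Lemma mass_law_tree n : ((\sum_(w <- words n) mass (law_tree w true))%:E =
  P [set x : Path | inI r (x n)])%E.
Proof.
have mI := measurable_stage_I r n.
have -> : P [set x : Path | inI r (x n)] =
    P ([set x : Path | hist_ok n x] `&` [set x : Path | inI r (x n)]).
  have mok : measurable [set x : Path | hist_ok n x].
    by apply: (hist_sets_measurable (n := n)); exact: hist_sets_ok.
  by rewrite setIC probability1_setI //; exact: hist_ok_as.
rewrite -visit_event_partition // -sumEFin; apply: eq_big_seq => w.
rewrite mem_words => /eqP sw.
have -> : visit_event w `&` [set x : Path | inI r (x n)] = visit_event (rcons w true).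
  rewrite visit_event_rcons sw; apply/seteqP; split => [x [h1 h2]|x [[h1 _] /asboolP h2]] //.
  by split; [split => //; case: h2|apply/asboolP].
rewrite massE dotr_law_tree.
rewrite (@eq_Rintegral _ _ _ _ _ (cst 1)); last first.
  by move=> x; rewrite inE => /event_simplex[_ h]; rewrite -massE.
rewrite Rintegral_cst; last exact: measurable_visit_event.
by rewrite mul1r fineK // fin_num_measure //; exact: measurable_visit_event.
Qed.

Lemma payoff_le_val : (payoff r delta P <= (val m lam r delta p1)%:E)%E.
Proof.
have /andP[d0 d1] := delta01.
have c0 n : 0 <= (1 - delta) * delta ^+ n by rewrite mulr_ge0 ?exprn_ge0 // subr_ge0 ltW.
rewrite payoffE //; apply: lime_le.
  by apply: is_cvg_nneseries => n _ _; rewrite mule_ge0 // lee_fin.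
apply: nearW => N; rewrite big_mkord.
rewrite (_ : (\sum_(i < N) _)%E = (tree_payoff delta N law_tree)%:E).
  rewrite lee_fin; apply: achieves_le_val => //; apply: achieves_payoff => //.
  exact: law_tree_tree.
by rewrite /tree_payoff -sumEFin; apply: eq_bigr => n _; rewrite -mass_law_tree -EFinM.
Qed.

End upper_bound.

(** * Two-point laws on beliefs *)

Section two_point.
Context {R : realType} {Om : finType}.
Local Notation Belief := (Belief R Om).
Local Notation Path := (Path R Om).

Definition choose_point (q q' : Belief) (b : bool) : Belief := if b then q else q'.

Lemma measurable_choose_point q q' : measurable_fun setT (choose_point q q').
Proof. by move=> _ B mB; rewrite setTI. Qed.

HB.instance Definition _ q q' :=
  @isMeasurableFun.Build _ _ _ _ (choose_point q q') (measurable_choose_point q q').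

(** Makes [two_point] a probability for every weight, so that strategies are defined on all
    histories, including those that leave the simplex. *)
Definition clamp (a : R) := Num.max 0 (Num.min 1 a).

Lemma clamp01 a : 0 <= clamp a <= 1.
Proof. by rewrite /clamp le_max lexx ge_max ler01 ge_min lexx. Qed.

Lemma clamp_id a : 0 <= a <= 1 -> clamp a = a.
Proof. by move=> /andP[a0 a1]; rewrite /clamp (min_idPr a1) (max_idPr a0). Qed.

Definition two_point (a : R) (q q' : Belief) : probability Belief R :=
  distribution (bernoulli_prob (clamp a)) (choose_point q q').

Lemma two_pointE a q q' (B : set Belief) :
  two_point a q q' B =
  ((clamp a)%:E * @dirac _ Belief q R B + (1 - clamp a)%:E * @dirac _ Belief q' R B)%E.
Proof. by rewrite /= /distribution /pushforward bernoulli_probE ?clamp01. Qed.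

Lemma integral_two_point_ge0 a q q' (f : Belief -> \bar R) :
  measurable_fun setT f -> (forall q, 0 <= f q)%E ->
  (\int[two_point a q q']_y f y = (clamp a)%:E * f q + (1 - clamp a)%:E * f q')%E.
Proof.
move=> mf f0; rewrite (ge0_integral_pushforward (measurable_choose_point q q')) //.
by rewrite preimage_setT integral_bernoulli_prob ?clamp01 // => b; exact: f0.
Qed.

Lemma integral_two_point a q q' (f : Belief -> R) :
  measurable_fun setT f -> 0 <= f q -> 0 <= f q' ->
  (\int[two_point a q q']_y (f y)%:E = (clamp a * f q + (1 - clamp a) * f q')%:E)%E.
Proof.
move=> mf fq fq'; have mf' : measurable_fun setT (EFin \o f) by exact/measurable_EFinP.
rewrite integralE !integral_two_point_ge0 //; try exact: measurable_funepos;
  try exact: measurable_funeneg.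
have pos y : 0 <= f y -> ((EFin \o f)^\+ y = (f y)%:E)%E.
  by move=> fy; rewrite funeposE; apply/max_idPl; rewrite lee_fin.
have neg y : 0 <= f y -> ((EFin \o f)^\- y = 0)%E.
  by move=> fy; rewrite funenegE; apply/max_idPr; rewrite leeNl oppe0 lee_fin.
by rewrite !pos // !neg // !mule0 adde0 sube0.
Qed.

End two_point.

(** * The greedy splitting as a measurable kernel *)

Section greedy_kernel.
Context {R : realType} {Om : finType} (r : Om -> R).
Local Notation Belief := (Belief R Om).
Implicit Types (p x : Om -> R).

Definition split_kernel x p : probability Belief R :=
  two_point (mass x) (post_I x p : Belief) (post_J x p : Belief).

Lemma split_kernelE x p (B : set Belief) :
  simplex p -> nonneg x -> nonneg (p \- x) ->
  split_kernel x p B = ((mass x)%:E * @dirac _ Belief (post_I x p) R B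
    + (1 - mass x)%:E * @dirac _ Belief (post_J x p) R B)%E.
Proof. by move=> ps x0 y0; rewrite two_pointE clamp_id // (mass_split01 ps). Qed.

Lemma split_kernel_splitting x p : simplex p -> nonneg x -> nonneg (p \- x) ->
  splitting p (split_kernel x p).
Proof.
move=> ps x0 y0; split.
  rewrite split_kernelE // !diracE !mem_set.
  - by rewrite !mule1 -EFinD addrC subrK.
  - exact: post_J_simplex.
  - exact: post_I_simplex.
move=> j; rewrite integral_two_point.
- by rewrite clamp_id ?(mass_split01 ps) // -post_mean.
- exact: measurable_coord.
- by case: (post_I_simplex ps x0).
- by case: (post_J_simplex ps y0).
Qed.

Lemma split_kernel_greedy p : (exists q, inI r q) -> simplex p ->
  greedy r p (split_kernel (knapsack r p) p).
Proof.
move=> [q0 q0I] ps; have [p0 p1] := ps.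
have x0 := knapsack_ge0 r p0; have y0 := knapsackB_ge0 r p0.
have [xr [b bB xE]] := knapsack_dual r p0.
split=> [[_ pr]|_] => [B mB|].
  rewrite split_kernelE // knapsack_id // /post_I.
  have -> : mass p = 1 by [].
  rewrite oner_eq0 invr1 subrr mul1e mul0e adde0.
  by have -> : 1 \*o p = p by apply/funext => j /=; rewrite mul1r.
(* When the mass is 0 the default posterior is [p], which is outside [I], whereas feasibility asks
   for a point of [I]. Any such point will do, since its weight is 0. *)
exists (mass (knapsack r p)),
  (if mass (knapsack r p) == 0 then q0 else post_I (knapsack r p) p),
  (post_J (knapsack r p) p); split; last split.
- split; first exact: (mass_split01 ps).
  split; first by case: eqP => // /eqP h; exact: post_I_inI.
  split; first exact: (post_J_simplex ps).
  move=> j; rewrite {1}(post_mean ps x0 y0); congr (_ + _).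
  by case: eqP => // ->; rewrite !mul0r.
(* [a] is the mass of [a \*o q], a competitor in the one-stage problem, and so at most the dual
   bound that the knapsack attains. *)
- move=> a q q' [/andP[a0 a1] [[[q0' q1] qr] [[q'0 _] E]]].
  rewrite xE.
  have -> : p = a \*o q \+ (1 - a) \*o q' by apply/funext => j; rewrite /= E.
  have aE : mass (a \*o q) = a by rewrite massZ /mass q1 mulr1.
  rewrite -[X in X <= _]aE; apply: mass_le_dual_split.
  + exact: breaks_ge0 bB.
  + exact: nonnegZ.
  + by apply: nonnegZ => //; rewrite subr_ge0.
  + by rewrite dotrZ mulr_ge0.
- move=> B mB; rewrite split_kernelE //; congr (_ + _)%E.
  by case: eqP => // ->; rewrite !mul0e.
Qed.

Lemma measurable_cond_sum (P : pred Om) (c : Om -> R) :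
  measurable_fun setT (fun q : Belief => \sum_(i | P i) q i * c i).
Proof.
under eq_fun do rewrite big_mkcond.
apply: measurable_sum => i; case: (P i) => //.
by apply: measurable_funM => //; exact: measurable_coord.
Qed.

Lemma measurable_knapsack : measurable_fun setT (fun q : Belief => knapsack r q : Belief).
Proof.
apply: measurable_fun_Belief => w.
have -> : (fun q : Belief => knapsack r q w) = if 0 <= r w then (fun q => q w)
    else (fun q => q w * Num.min 1 (Num.max 0 (above r w q / level r w q))).
  by apply/funext => q; rewrite /knapsack; case: ifP.
case: ifP => _; first exact: measurable_coord.
apply: measurable_funM; first exact: measurable_coord.
apply: measurable_minr => //; apply: measurable_maxr => //.
apply: measurable_funM; first exact: measurable_cond_sum.
by apply: measurable_invr; exact: measurable_cond_sum.
Qed.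

Let mass_mK : measurable_fun setT (fun q : Belief => mass (knapsack r q)).
Proof. exact: (measurableT_comp measurable_mass measurable_knapsack). Qed.

Let K_coord j : measurable_fun setT (fun q : Belief => knapsack r q j).
Proof. exact: (measurableT_comp (measurable_coord j) measurable_knapsack). Qed.

Lemma measurable_post_I : measurable_fun setT (fun q : Belief => post_I (knapsack r q) q : Belief).
Proof.
apply: measurable_fun_Belief => j.
have -> : (fun q : Belief => post_I (knapsack r q) q j) = (fun q => if mass (knapsack r q) == 0 then q j
  else (mass (knapsack r q))^-1 * knapsack r q j).
  by apply/funext => q; rewrite /post_I; case: ifP.
apply: measurable_fun_ifT.
- exact: measurable_fun_eqr.
- exact: measurable_coord.
- by apply: measurable_funM => //; exact: measurable_invr.
Qed.

Lemma measurable_post_J : measurable_fun setT (fun q : Belief => post_J (knapsack r q) q : Belief).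
Proof.
have m1 : measurable_fun setT (fun q : Belief => 1 - mass (knapsack r q)).
  exact: measurable_funB.
apply: measurable_fun_Belief => j.
have -> : (fun q : Belief => post_J (knapsack r q) q j) = (fun q => if 1 - mass (knapsack r q) == 0 then q j
  else (1 - mass (knapsack r q))^-1 * (q j - knapsack r q j)).
  by apply/funext => q; rewrite /post_J; case: ifP.
apply: measurable_fun_ifT.
- exact: measurable_fun_eqr.
- exact: measurable_coord.
- apply: measurable_funM; first exact: measurable_invr.
  by apply: measurable_funB => //; exact: measurable_coord.
Qed.

Lemma measurable_greedy_kernel (B : set Belief) : measurable B ->
  measurable_fun setT (fun q : Belief => split_kernel (knapsack r q) q B).
Proof.
move=> mB; under eq_fun do rewrite two_pointE !diracE.
have mc : measurable_fun setT (fun q : Belief => clamp (mass (knapsack r q))).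
  by apply: measurable_maxr => //; exact: measurable_minr.
have mi (g : Belief -> Belief) : measurable_fun setT g ->
    measurable_fun setT (fun q => ((g q \in B)%:R : R)).
  move=> mg; have : measurable_fun setT (\1_B \o g : Belief -> R).
    by apply: measurableT_comp => //; exact: measurable_indic.
  by apply: eq_measurable_fun => q _; rewrite /= indicE.
apply: emeasurable_funD; apply: emeasurable_funM; apply/measurable_EFinP => //.
- by apply: mi; exact: measurable_post_I.
- exact: measurable_funB.
- by apply: mi; exact: measurable_post_J.
Qed.

End greedy_kernel.

(** * The uniform variable that drives the draws *)

Section uniform_interval.
Context {R : realType}.

Definition unif01 : probability (measurableTypeR R) R := uniform_prob (@ltr01 R).

Lemma unif01_itv (a b : R) : 0 <= a -> a <= b -> b <= 1 -> unif01 [set` `[a, b[] = (b - a)%:E.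
Proof.
move=> a0 ab b1.
have mI : measurable ([set` `[a, b[] : set (measurableTypeR R)) by exact: measurable_itv.
rewrite -[LHS]mule1 -[X in (_ * X)%E]/(1%:E) muleC -integral_cst // integral_mkcond.
rewrite integral_uniform //; last 2 first.
- by apply/(measurable_restrictT _ _).1.
- by move=> x; rewrite patchE; case: ifP.
rewrite subr0 invr1 mul1e -integral_mkcondr setIidr; last first.
  by move=> x /=; rewrite !in_itv /= => /andP[h1 h2]; rewrite (le_trans a0) //= ltW // (lt_le_trans h2).
rewrite integral_cst // mul1e; transitivity (lebesgue_measure [set` `[a, b[]) => //.
rewrite lebesgue_measure_itv /= lte_fin.
by case: ltgtP ab => // -> _; rewrite subrr.
Qed.

End uniform_interval.

(** * The law of play along a tree of two-point splittings *)

Section tree_law.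
Context {R : realType} {Om : finType} (m : Om -> R) (lam : R) (p1 : Om -> R)
  (f : (Om -> R) -> (Om -> R)).
Hypothesis m_simplex : simplex m.
Hypothesis lam01 : 0 <= lam < 1.
Hypothesis p1_simplex : simplex p1.
Hypothesis f_ge0 : forall p, simplex p -> nonneg (f p).
Hypothesis f_le : forall p, simplex p -> nonneg (p \- f p).
Local Notation Path := (Path R Om).
Local Notation Belief := (Belief R Om).
Local Notation M := (trans lam m).
Implicit Types (w v : seq bool) (b : bool).

Definition post b (x p : Om -> R) := if b then post_I x p else post_J x p.

(* Nodes are words with the most recent draw first. *)
Fixpoint node_belief w : Om -> R :=
  if w is b :: v then phi M (post b (f (node_belief v)) (node_belief v)) else p1.

Definition node_post w b := post b (f (node_belief w)) (node_belief w).

Definition node_prob w b : R :=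
  if b then mass (f (node_belief w)) else 1 - mass (f (node_belief w)).

(** Each node owns a subinterval of [[0, 1[] whose length is its probability. The left part, in
    proportion to the weight of the first posterior, goes to the child [true]. *)
Fixpoint node_itv w : R * R :=
  if w is b :: v then
    let: (l, h) := node_itv v in
    let c := l + node_prob v true * (h - l) in if b then (l, c) else (c, h)
  else (0, 1).

Definition lo w := (node_itv w).1.
Definition hi w := (node_itv w).2.
Definition cut w := lo w + node_prob w true * (hi w - lo w).
Definition len w := hi w - lo w.

Lemma node_belief_simplex w : simplex (node_belief w).
Proof.
elim: w => //= b v IH; apply: phi_simplex => //; rewrite /post.
by case: b; [apply: post_I_simplex|apply: post_J_simplex] => //; auto.
Qed.

Lemma node_post_simplex w b : simplex (node_post w b).
Proof.
have h := node_belief_simplex w; rewrite /node_post /post.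
by case: b; [apply: post_I_simplex|apply: post_J_simplex] => //; auto.
Qed.

Lemma node_prob01 w b : 0 <= node_prob w b <= 1.
Proof.
have h := node_belief_simplex w.
have := mass_split01 h (f_ge0 h) (f_le h).
by rewrite /node_prob; case: b => // /andP[h0 h1]; rewrite subr_ge0 h1 gerBl.
Qed.

Lemma lo_cons b v : lo (b :: v) = if b then lo v else cut v.
Proof. by rewrite /lo /cut /hi /lo /=; case: (node_itv v) => l h; case: b. Qed.

Lemma hi_cons b v : hi (b :: v) = if b then cut v else hi v.
Proof. by rewrite /hi /cut /hi /lo /=; case: (node_itv v) => l h; case: b. Qed.

Lemma len_nil : len [::] = 1.
Proof. by rewrite /len /lo /hi /= subr0. Qed.

Lemma len_cons b v : len (b :: v) = len v * node_prob v b.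
Proof. by rewrite /len lo_cons hi_cons /cut; case: b; rewrite /node_prob; ring. Qed.

Lemma node_itv_bounds w : [/\ 0 <= lo w, lo w <= hi w & hi w <= 1].
Proof.
elim: w => [|b v [l0 lh h1]]; first by rewrite /lo /hi /= lexx ler01.
have /andP[a0 a1] := node_prob01 v true.
have d0 : 0 <= hi v - lo v by rewrite subr_ge0.
have c0 : lo v <= cut v by rewrite /cut lerDl mulr_ge0.
have c1 : cut v <= hi v.
  by rewrite /cut -lerBrDl ler_piMl.
rewrite lo_cons hi_cons; case: b; split => //; first exact: le_trans c1 h1.
exact: le_trans l0 c0.
Qed.

Lemma len_ge0 w : 0 <= len w.
Proof. by rewrite subr_ge0; case: (node_itv_bounds w). Qed.

Lemma cut_bounds v : lo v <= cut v <= hi v.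
Proof.
have [_ h1 _] := node_itv_bounds (true :: v).
have [_ h2 _] := node_itv_bounds (false :: v).
by move: h1 h2; rewrite !lo_cons !hi_cons => -> ->.
Qed.

Lemma sum_len n : \sum_(w <- words n) len w = 1.
Proof.
elim: n => [|n IH]; first by rewrite big_seq1 len_nil.
rewrite big_words_cons2 /= -[RHS]IH; apply: eq_bigr => v _.
by rewrite !len_cons /node_prob -mulrDr addrC subrK mulr1.
Qed.

(** For [u] in [[0, 1[], the node of depth [n] whose interval contains [u]. *)
Fixpoint word n (u : R) : seq bool :=
  if n is k.+1 then (u < cut (word k u)) :: word k u else [::].

Lemma size_word n u : size (word n u) = n.
Proof. by elim: n => //= n ->. Qed.

Lemma wordP n w u : size w = n -> 0 <= u < 1 -> (word n u = w) <-> (lo w <= u < hi w).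
Proof.
move=> + u01; elim: n w => [|n IH] [|b v] //= [sv]; have /andP[lc ch] := cut_bounds v.
rewrite lo_cons hi_cons; split.
  move=> [<- wv]; rewrite wv; have /andP[h1 h2] := (IH v sv).1 wv.
  by case: ltP => h; [rewrite h1|rewrite h2 andbT].
move=> h; have wv : word n u = v.
  apply/(IH v sv); case: b h => /andP[h1 h2].
    by rewrite h1 (lt_le_trans h2).
  by rewrite h2 (le_trans lc).
rewrite wv; congr (_ :: _); case: b h => /andP[h1 h2]; first by rewrite h2.
by rewrite ltNge h1.
Qed.

Lemma measurable_word n w : measurable [set u : measurableTypeR R | word n u = w].
Proof.
elim: n w => [|n IH] w.
  have [->|wn] := eqVneq w [::].
    by rewrite (_ : [set u | _] = setT) //; apply/seteqP; split.
  rewrite (_ : [set u | _] = set0) //; apply/seteqP; split => // u /= e.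
  by rewrite -e eqxx in wn.
case: w => [|b v].
  by rewrite (_ : [set u | _] = set0) //; apply/seteqP; split.
rewrite (_ : [set u | _] = [set u : measurableTypeR R | word n u = v] `&`
    (if b then [set` `]-oo, cut v[] else [set` `[cut v, +oo[])).
  by apply: measurableI => //; case: b; exact: measurable_itv.
apply/seteqP; split => u /=.
  by move=> [<- ->]; split => //; case: ltP => h; rewrite /= in_itv /= ?andbT.
move=> [-> h]; congr (_ :: _); case: b h; rewrite /= in_itv /= ?andbT => //.
by rewrite leNgt => /negbTE.
Qed.

Lemma unif01_word n w : size w = n -> unif01 [set u | word n u = w] = (len w)%:E.
Proof.
move=> sw; have [l0 lh h1] := node_itv_bounds w.
have m01 : measurable ([set` `[0, 1[] : set (measurableTypeR R)) by exact: measurable_itv.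
rewrite -(probability1_setI m01 (measurable_word n w)); last first.
  by rewrite unif01_itv // subr0.
rewrite (_ : _ `&` _ = [set` `[lo w, hi w[]) ?unif01_itv //.
apply/seteqP; split => u /=; rewrite !in_itv /=.
  by move=> [h1' h2]; exact/(wordP sw h2).
move=> /andP[h2 h3]; have u01 : 0 <= u < 1.
  by rewrite (le_trans l0) // (lt_le_trans h3).
by split => //; apply/(wordP sw u01); rewrite h2.
Qed.

Lemma bigcup_words_measurable d (T : measurableType d) n (E : seq bool -> set T) (Q : seq bool -> Prop) :
  (forall w, size w = n -> measurable (E w)) ->
  measurable (\bigcup_(w in [set w | w \in words n /\ Q w]) E w).
Proof.
move=> mE; apply: fin_bigcup_measurable.
  apply: (@sub_finite_set _ _ [set` words n]); last exact: finite_seq.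
  by move=> w [].
by move=> w [+ _]; rewrite mem_words => /eqP; exact: mE.
Qed.

Lemma measurable_fun_word d (T : measurableType d) n (H : seq bool -> T) :
  measurable_fun setT (fun u : measurableTypeR R => H (word n u)).
Proof.
move=> _ Y mY; rewrite setTI.
rewrite (_ : _ @^-1` _ = \bigcup_(w in [set w | w \in words n /\ Y (H w)])
    [set u : measurableTypeR R | word n u = w]).
  by apply: bigcup_words_measurable => w _; exact: measurable_word.
apply/seteqP; split => u /=.
  by move=> Yu; exists (word n u) => //=; rewrite mem_words size_word.
by move=> [w [_ Yw] ->].
Qed.

Lemma integral_word n (H : seq bool -> \bar R) : (forall w, 0 <= H w)%E ->
  (\int[unif01]_u H (word n u) = \sum_(w <- words n) (len w)%:E * H w)%E.
Proof.
move=> H0.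
transitivity (\int[unif01]_u \sum_(w <- words n)
    H w * (\1_[set u : measurableTypeR R | word n u = w] u)%:E)%E.
  apply: eq_integral => u _.
  rewrite (bigD1_seq (word n u)) /=; last 2 first.
  - by rewrite mem_words size_word.
  - exact: uniq_words.
  rewrite indicE mem_set // mule1 big1 ?adde0 // => w wu.
  rewrite indicE memNset ?mule0 //= => e; by rewrite e eqxx in wu.
rewrite ge0_integral_sum //; last 2 first.
- move=> w; apply: emeasurable_funM => //; apply/measurable_EFinP.
  by apply: measurable_indic; exact: measurable_word.
- by move=> w u _; rewrite mule_ge0 // lee_fin indicE.
apply: eq_big_seq => w; rewrite mem_words => /eqP sw.
rewrite ge0_integralZl //; last first.
  by apply/measurable_EFinP; apply: measurable_indic; exact: measurable_word.
rewrite integral_indic; [|exact: measurableT|exact: measurable_word].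
by rewrite setIT muleC; congr (_ * _)%E; exact: unif01_word.
Qed.

(** A single uniform number determines every draw, so the law on infinite paths is an image
    measure. *)
Definition path_of (u : measurableTypeR R) : Path :=
  fun k => node_post (word k u) (u < cut (word k u)).

Lemma path_ofE u k : path_of u k = node_post (behead (word k.+1 u)) (head true (word k.+1 u)).
Proof. by []. Qed.

Lemma measurable_path_of : measurable_fun setT path_of.
Proof.
apply: (@measurability _ _ _ Path setT path_of (@path_gen R Om)) => //.
move=> _ [_ [k [j [B [mB ->]]]] <-].
pose H w := node_post (behead w) (head true w) j.
have := @measurable_fun_word _ R k.+1 H measurableT B mB.
by congr measurable.
Qed.

HB.instance Definition _ := @isMeasurableFun.Build _ _ _ _ path_of measurable_path_of.

Definition tree_law : probability Path R := distribution unif01 path_of.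

Lemma integral_tree_law n (h : Path -> \bar R) (H : seq bool -> \bar R) :
  measurable_fun setT h -> (forall x, 0 <= h x)%E -> (forall w, 0 <= H w)%E ->
  (forall u, h (path_of u) = H (word n u)) ->
  (\int[tree_law]_x h x = \sum_(w <- words n) (len w)%:E * H w)%E.
Proof.
move=> mh h0 H0 hH; rewrite (ge0_integral_pushforward measurable_path_of) //.
rewrite preimage_setT -integral_word //; apply: eq_integral => u _.
exact: hH.
Qed.

Lemma tree_law_set n (E : set Path) (Q : seq bool -> Prop) : measurable E ->
  (forall u, E (path_of u) <-> Q (word n u)) ->
  tree_law E = (\sum_(w <- words n) len w * (`[< Q w >])%:R)%:E.
Proof.
move=> mE EQ; rewrite -[E in LHS]setIT -integral_indic //.
rewrite (@integral_tree_law n _ (fun w => (`[< Q w >]%:R)%:E)).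
- by rewrite -sumEFin; apply: eq_bigr => w _; rewrite EFinM.
- by apply/measurable_EFinP; exact: measurable_indic.
- by move=> x; rewrite lee_fin indicE.
- by move=> w; rewrite lee_fin.
- move=> u; rewrite indicE; congr (_%:R%:E); congr nat_of_bool.
  by apply/idP/asboolP; rewrite inE => /EQ.
Qed.

(** Different words may describe one history, for instance when a posterior of probability 0
    defaults to the prior. By [on_node_belief] the belief is then the same for all of them. *)
Fixpoint on_node w (x : nat -> Om -> R) : Prop :=
  if w is b :: v then on_node v x /\ x (size v) = node_post v b else True.

Definition on_tree n (x : nat -> Om -> R) := exists2 w, size w = n & on_node w x.

Lemma on_node_belief w x : on_node w x -> belief M p1 (size w) x = node_belief w.
Proof. by case: w => //= b v [_ ->]. Qed.

Lemma on_node_word n u : on_node (word n u) (path_of u).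
Proof. by elim: n => //= n IH; rewrite size_word. Qed.

Lemma on_node_agree w x y : (forall k, (k < size w)%N -> x k = y k) ->
  on_node w x -> on_node w y.
Proof.
elim: w => //= b v IH xy [xv e]; split; last by rewrite -xy.
by apply: IH => // k kv; apply: xy; rewrite ltnW.
Qed.

Lemma belief_agree n (x y : nat -> Om -> R) : (forall k, (k < n)%N -> x k = y k) ->
  belief M p1 n x = belief M p1 n y.
Proof. by case: n => //= n -> . Qed.

Lemma measurable_point (q : Belief) : measurable [set q].
Proof.
have -> : [set q] = \bigcap_(j in setT) [set q' : Belief | [set q j] (q' j)].
  apply/seteqP; split => [q' -> //|q' h]; apply/funext => j; exact: (h j).
apply: fin_bigcap_measurable => // j _.
by have := measurable_coord j measurableT (@measurable_set1 _ (q j)); rewrite setTI.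
Qed.

Lemma hist_sets_on_node w : hist_sets (size w) [set x | on_node w x].
Proof.
elim: w => [|b v IH] /=; first exact: (@measurableT _ (Hist 0)).
apply: hist_setsI; first exact: hist_sets_le IH.
by apply: (@hist_sets_stage _ _ _ (size v) [set node_post v b]) => //; exact: measurable_point.
Qed.

Lemma measurable_belief n : measurable_fun setT (fun x : Hist n => belief M p1 n x : Belief).
Proof.
case: n => [|n]; first exact: measurable_cst.
apply: measurable_fun_Belief => j /=.
have := measurableT_comp (measurable_dotr (fun i => M i j)) (measurable_stage_hist (ltnSn n)).
exact.
Qed.

End tree_law.

(** The sets that do not separate histories agreeing before [n] form a sigma-algebra that contains
    the generators. *)
Lemma hist_sets_agree (R : realType) (Om : finType) n (A : set (nat -> Om -> R)) x y :
  hist_sets n A -> (forall k, (k < n)%N -> x k = y k) -> A x -> A y.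
Proof.
move=> hA xy.
pose C := [set A : set (nat -> Om -> R) | forall x y, (forall k, (k < n)%N -> x k = y k) -> A x -> A y].
suff : C A by apply.
apply: (smallest_sub _ _ hA).
  split.
  - by [].
  - move=> B CB u v uv [_ nB]; split => // Bv; apply: nB; apply: CB Bv => k kn.
    by rewrite uv.
  - by move=> F CF u v uv [k _ Fu]; exists k => //; exact: CF Fu.
by move=> _ [k [w [B [kn [_ ->]]]]] u v uv /=; rewrite uv.
Qed.

(** * The optimal strategy and its hitting time of the cones *)

Section optimal_strategy.
Context {R : realType} {Om : finType} (m : Om -> R) (lam : R) (r : Om -> R)
  (delta : R) (p1 : Om -> R) (f : (Om -> R) -> (Om -> R)).
Hypothesis m_simplex : simplex m.
Hypothesis lam01 : 0 <= lam < 1.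
Hypothesis delta01 : 0 <= delta < 1.
Hypothesis p1_simplex : simplex p1.
Hypothesis I_nonempty : exists q, inI r q.
Local Notation Path := (Path R Om).
Local Notation Belief := (Belief R Om).
Local Notation M := (trans lam m).
Local Notation phi := (phi M).
Local Notation val := (val m lam r delta).
Local Notation core := (core m r).
Local Notation loss := (loss m lam r delta).
Hypothesis f_optimal : forall p, nonneg p ->
  [/\ nonneg (f p), nonneg (p \- f p), 0 <= dotr (f p) r,
      val p = (1 - delta) * mass (f p) + delta * (val (phi (f p)) + val (phi (p \- f p)))
    & core p -> f p = knapsack r p].

Local Notation node_belief := (node_belief m lam p1 f).
Local Notation node_post := (node_post m lam p1 f).
Local Notation node_prob := (node_prob m lam p1 f).
Local Notation len := (len m lam p1 f).
Local Notation word := (word m lam p1 f).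
Local Notation path_of := (path_of m lam p1 f).
Local Notation on_node := (on_node m lam p1 f).
Local Notation on_tree := (on_tree m lam p1 f).
Local Notation tree_law := (tree_law m lam p1 f).

Let f_ge0 p : simplex p -> nonneg (f p).
Proof. by case=> p0 _; case: (f_optimal p0). Qed.
Let f_le p : simplex p -> nonneg (p \- f p).
Proof. by case=> p0 _; case: (f_optimal p0). Qed.

Let nb_simplex w : simplex (node_belief w).
Proof. exact: node_belief_simplex. Qed.
Let np_simplex w b : simplex (node_post w b).
Proof. exact: node_post_simplex. Qed.
Let len0 w : 0 <= len w.
Proof. exact: len_ge0. Qed.

Definition strat_split n (x : nat -> Om -> R) : Om -> R :=
  if `[< on_tree n x >] then f (belief M p1 n x) else knapsack r (belief M p1 n x).

(* Off the countable tree of histories generated by [f] the strategy is greedy;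
   this makes it measurable although [f] is an arbitrary selection. *)
Definition strat : strategy R Om :=
  fun n x => split_kernel (strat_split n x) (belief M p1 n x).

Lemma belief_simplex n (x : nat -> Om -> R) : hist_ok n x -> simplex (belief M p1 n x).
Proof. by case: n => //= n h; apply: phi_simplex => //; exact: h. Qed.

Lemma strat_node w x B : on_node w x ->
  strat (size w) x B = split_kernel (f (node_belief w)) (node_belief w) B.
Proof.
move=> xw; rewrite /strat /strat_split (on_node_belief xw).
by case: asboolP => // -[]; exists w.
Qed.

Lemma strat_agree n (x y : Path) : (forall k, (k < n)%N -> x k = y k) -> strat n x = strat n y.
Proof.
move=> xy; rewrite /strat /strat_split (belief_agree _ _ _ xy).
suff -> : on_tree n x = on_tree n y by [].
rewrite propeqE; split => -[w sw h]; exists w => //; apply: on_node_agree h => k; rewrite sw => kn.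
  exact: xy.
by rewrite xy.
Qed.

(** On each of the finitely many nodes of depth [n] the kernel is constant, whatever [f] is;
    elsewhere it is the greedy kernel, measurable in the belief. *)
Lemma strat_measurable n (B : set Belief) : measurable B ->
  forall Y : set (\bar R), measurable Y -> hist_sets n ((fun x : Path => strat n x B) @^-1` Y).
Proof.
move=> mB Y mY.
pose T := \bigcup_(w in [set w | w \in words n /\ True]) [set x : Hist n | on_node w x].
pose TY := \bigcup_(w in [set w | w \in words n /\
  Y (split_kernel (f (node_belief w)) (node_belief w) B)]) [set x : Hist n | on_node w x].
pose G := [set x : Hist n | Y (split_kernel (knapsack r (belief M p1 n x)) (belief M p1 n x) B)].
have mnode w : size w = n -> measurable [set x : Hist n | on_node w x].
  by move=> <-; exact: hist_sets_on_node.
have mT : measurable T by exact: bigcup_words_measurable.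
have mTY : measurable TY by exact: bigcup_words_measurable.
have mG : measurable G.
  have := measurableT_comp (measurable_greedy_kernel r mB) (@measurable_belief _ _ m lam p1 n).
  by move=> /(_ measurableT Y mY); rewrite setTI.
have TP x : T x <-> on_tree n x.
  split=> [[w [wn _] xw]|[w sw xw]]; exists w => //; last by split=> //; rewrite mem_words sw.
  by apply/eqP; rewrite -mem_words.
rewrite (_ : _ @^-1` _ = TY `|` (~` T `&` G)).
  apply: (@measurableU _ (Hist n)) => //; apply: (@measurableI _ (Hist n)) => //.
  exact: (@measurableC _ (Hist n)).
apply/seteqP; split => x /=.
  have [[w sw xw]|nt] := pselect (on_tree n x).
    have := strat_node B xw; rewrite sw => E Yx; left; exists w => //.
    by split; [rewrite mem_words sw|rewrite -E].
  move=> Yx; right; split; first by move/TP.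
  by move: Yx; rewrite /strat /strat_split /G /=; case: asboolP.
move=> [[w [wn Yw] xw]|[nT Gx]].
  have := strat_node B xw; move: wn; rewrite mem_words => /eqP -> E.
  by move: Yw; rewrite -E.
by rewrite /strat /strat_split; case: asboolP => // /TP.
Qed.

Lemma strat_ok : strategy_ok M p1 strat.
Proof.
split; first exact: strat_agree; split; first exact: strat_measurable.
move=> n x hx; have bs := belief_simplex hx; have [b0 _] := bs.
apply: split_kernel_splitting => //; rewrite /strat_split; case: asboolP => _.
- exact: f_ge0.
- exact: knapsack_ge0.
- exact: f_le.
- exact: knapsackB_ge0.
Qed.

Lemma path_agree n u u' : word n u = word n u' ->
  forall k, (k < n)%N -> path_of u k = path_of u' k.
Proof.
elim: n => // n IH e k; rewrite ltnS leq_eqVlt => /orP[/eqP ->|]; first by rewrite !path_ofE e.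
by apply: IH; case: e.
Qed.

Lemma strat_law : induced_law strat tree_law.
Proof.
move=> n A B hA mB; have mA := hist_sets_measurable hA.
have mBn : measurable [set x : Path | B (x n)].
  by have := measurable_stage n measurableT mB; rewrite setTI.
(* [A] depends only on the first [n] posteriors, thus on [u] only through [word n u]; both sides
   become finite sums over words. *)
pose Aw w := exists2 u, word n u = w & A (path_of u).
have AwP u : A (path_of u) <-> Aw (word n u).
  split=> [Au|[u' e Au]]; first by exists u.
  exact: (hist_sets_agree hA (path_agree e)).
pose H w : \bar R := ((`[< Aw w >])%:R%:E *
  split_kernel (f (node_belief w)) (node_belief w) B)%E.
transitivity (\sum_(w <- words n) (len w)%:E * H w)%E.
  rewrite (@tree_law_set _ _ _ _ _ _ _ _ _ _ _ n.+1 _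
    (fun w => Aw (behead w) /\ B (node_post (behead w) (head true w)))) //; last 2 first.
  - exact: measurableI.
  - move=> u /=; split; [move=> [/AwP]|move=> [/AwP]]; by [].
  rewrite big_words_cons2 -sumEFin; apply: eq_bigr => v _ /=.
  have sv := nb_simplex v.
  rewrite /H (split_kernelE _ sv (f_ge0 sv) (f_le sv)) !len_cons !diracE.
  rewrite -!EFinM; congr _%:E; rewrite !asbool_and /=.
  have E (q : Belief) : `[< B q >] = (q \in B).
    by apply/idP/idP => [/asboolP h|/set_mem h]; [exact: mem_set|apply/asboolP].
  rewrite !E /node_post /post /node_prob.
  by case: `[< Aw v >]; case: (_ \in B); case: (_ \in B) => /=; ring.
rewrite integral_mkcond.
rewrite (@integral_tree_law _ _ _ _ _ _ _ _ _ _ _ n _ H) //.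
- apply/(measurable_restrictT _ _).1 => //; apply: (@measurable_funS _ _ _ _ setT) => //.
  move=> _ Y mY; rewrite setTI; apply: (@hist_sets_measurable _ _ n).
  exact: strat_measurable.
- by move=> x; rewrite patchE; case: ifP.
- by move=> w; rewrite mule_ge0.
- move=> u; rewrite patchE /H; case: (boolP (_ \in _)).
    rewrite inE => /AwP Au; rewrite (asboolT Au) mul1e.
    by rewrite -[n in strat n](size_word m lam p1 f n u) strat_node //; exact: on_node_word.
  rewrite notin_setE => nA; rewrite (asboolF _) ?mul0e // => /AwP; exact: nA.
Qed.

Lemma core_node w x k : on_node w x -> (k <= size w)%N -> core (belief M p1 k x) ->
  core (node_belief w).
Proof.
elim: w => [|b v IH]; first by case: k.
move=> xw; rewrite leq_eqVlt => /orP[/eqP ->|]; first by rewrite (on_node_belief xw).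
case: xw => xv _; rewrite ltnS => kv /(IH xv kv) cv /=.
have ps := nb_simplex v; have [p0 _] := ps.
have [x0 y0 xr _ /(_ cv) fE] := f_optimal p0.
(* Serves the default posteriors, whose image under [phi] is that of the prior. *)
have cphi : core (phi (node_belief v)).
  by case: cv => c [cB cm cp]; exists c; split => //; exact: cell_phi.
have [cx cy] := core_knapsack lam01 cv; rewrite -fE in cx cy.
have scaled t q : 0 <= t -> t != 0 -> core (phi (t \*o q)) -> core (phi q).
  by move=> t0 tn0; rewrite phiZ; apply: coreZ; rewrite lt_neqAle eq_sym tn0.
have /andP[a0 a1] := mass_split01 ps x0 y0.
case: b => /=.
  have [e|ne] := eqVneq (mass (f (node_belief v))) 0; first by rewrite /post_I e eqxx.
  by apply: (scaled _ _ a0 ne); rewrite post_IE.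
have [e|ne] := eqVneq (1 - mass (f (node_belief v))) 0; first by rewrite /post_J e eqxx.
by apply: (@scaled (1 - mass (f (node_belief v)))) => //; rewrite ?subr_ge0 // post_JE.
Qed.

Lemma strat_greedy n (x : Path) k : hist_ok n x -> (k <= n)%N -> core (belief M p1 k x) ->
  greedy r (belief M p1 n x) (strat n x).
Proof.
move=> hx kn ck; have bs := belief_simplex hx.
rewrite /strat /strat_split; case: asboolP => [[w sw xw]|_]; last exact: split_kernel_greedy.
have b0 : nonneg (belief M p1 n x) by case: bs.
have [_ _ _ _ ->] := f_optimal b0; first exact: split_kernel_greedy.
by rewrite -sw (on_node_belief xw); apply: (core_node xw _ ck); rewrite sw.
Qed.

(** Homogeneity absorbs the weights: an expectation over the two posteriors becomes a sum over the
    unnormalised pieces. Applied to the value after [phi] and to the loss. *)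
Lemma node_split (g : (Om -> R) -> R) w :
  (forall t q, 0 <= t -> nonneg q -> g (t \*o q) = t * g q) ->
  node_prob w true * g (node_post w true) + node_prob w false * g (node_post w false)
  = g (f (node_belief w)) + g (node_belief w \- f (node_belief w)).
Proof.
move=> gZ; have ps := nb_simplex w.
have /andP[a0 a1] := mass_split01 ps (f_ge0 ps) (f_le ps).
have [I0 _] := np_simplex w true; have [J0 _] := np_simplex w false.
rewrite /node_prob -!gZ ?subr_ge0 //.
by rewrite /node_post /post post_IE ?post_JE //; [exact: f_le|exact: f_ge0].
Qed.

Lemma val_node w : val (node_belief w) = (1 - delta) * node_prob w true +
  delta * (node_prob w true * val (node_belief (true :: w))
         + node_prob w false * val (node_belief (false :: w))).
Proof.
have [p0 _] := nb_simplex w; have [_ _ _ -> _] := f_optimal p0.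
congr (_ + _ * _); rewrite (node_split (g := fun q => val (phi q))) // => t q t0 q0.
by rewrite phiZ val_scale //; exact: phi_ge0.
Qed.

Lemma val_expand N : val p1 =
  \sum_(n < N) (1 - delta) * delta ^+ n * (\sum_(w <- words n) len w * node_prob w true)
  + delta ^+ N * \sum_(w <- words N) len w * val (node_belief w).
Proof.
elim: N => [|N IH].
  by rewrite big_ord0 add0r expr0 mul1r big_seq1 len_nil mul1r.
rewrite IH big_ord_recr /= -addrA; congr (_ + _).
rewrite big_words_cons2 exprS -!mulrA !mulr_sumr -big_split; apply: eq_bigr => w _ /=.
by rewrite val_node !len_cons /=; ring.
Qed.

Lemma payoff_ge_val : ((val p1)%:E <= payoff r delta tree_law)%E.
Proof.
have /andP[d0 d1] := delta01.
have c0 n : 0 <= (1 - delta) * delta ^+ n by rewrite mulr_ge0 ?exprn_ge0 // subr_ge0 ltW.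
have le1 N : \sum_(w <- words N) len w * val (node_belief w) <= 1.
  rewrite -(sum_len m lam p1 f N); apply: ler_sum => w _.
  have [p0 q1] := nb_simplex w.
  rewrite ler_piMr // (le_trans (val_le_mass _ _ _ _ p0)) //.
  by rewrite /mass q1.
(* Only an inequality, since the second posterior may lie in [I] too. *)
have visit n : ((\sum_(w <- words n) len w * node_prob w true)%:E <=
    tree_law [set x : Path | inI r (x n)])%E.
  have E := tree_law_set m_simplex lam01 p1_simplex f_ge0 f_le (n := n.+1)
    (Q := fun w => inI r (node_post (behead w) (head true w)))
    (measurable_stage_I r n) (fun u => iff_refl _).
  rewrite -[leRHS]/(tree_law [set x : Path | inI r (x n)]) [leRHS]E.
  rewrite lee_fin big_words_cons2; apply: ler_sum => v _ /=.
  rewrite !len_cons; apply: (@le_trans _ _ (len v * node_prob v true *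
    (`[< inI r (node_post v true) >])%:R)); last first.
    rewrite lerDl !mulr_ge0 //.
    by case/andP: (node_prob01 m_simplex lam01 p1_simplex f_ge0 f_le v false).
  have [e|ne] := eqVneq (node_prob v true) 0; first by rewrite -[leLHS]/(len v * node_prob v true) e mulr0 mul0r.
  have ps := nb_simplex v; have [p0 _] := ps; have [x0 _ xr _ _] := f_optimal p0.
  by rewrite asboolT ?mulr1 //; exact: post_I_inI.
have partial N : ((val p1 - delta ^+ N)%:E <= payoff r delta tree_law)%E.
  rewrite payoffE //; apply: le_trans (nneseries_lim_ge N _); last first.
    by move=> n _ _; rewrite mule_ge0 // lee_fin.
  rewrite big_mkord (val_expand N).
  apply: (@le_trans _ _ (\sum_(n < N) (1 - delta) * delta ^+ n *
      (\sum_(w <- words n) len w * node_prob w true))%:E).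
    rewrite lee_fin -addrA gerDl subr_le0 ler_piMr ?exprn_ge0 //.
  rewrite -sumEFin; apply: lee_sum => n _.
  by rewrite [leLHS]EFinM lee_wpmul2l ?lee_fin.
(* The upper bound valid for all strategies and the partial lower bound exclude infinite payoffs. *)
have [v pE] : exists v, payoff r delta tree_law = v%:E.
  have := payoff_le_val r m_simplex delta01 strat_ok strat_law.
  have := partial 0%N; case: (payoff r delta tree_law) => [v||] //; by exists v.
rewrite pE lee_fin; apply: (@le_geometric _ delta _ _ 1 delta01) => N.
by have := partial N; rewrite pE lee_fin mulr1 lerBlDr.
Qed.

Lemma payoff_value : payoff r delta tree_law = value M r delta p1.
Proof.
apply/eqP; rewrite eq_le; apply/andP; split.
  by apply: ereal_sup_ubound; exists strat, tree_law; split; [exact: strat_ok|split; [exact: strat_law|]].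
apply: le_trans payoff_ge_val; apply: ub_ereal_sup => _ [s [P [sok [slaw ->]]]].
exact: (payoff_le_val r m_simplex delta01 sok slaw).
Qed.

Lemma node_loss c w : c \in breaks r -> cell r c m ->
  node_prob w true * loss c (node_post w true) + node_prob w false * loss c (node_post w false)
  <= loss c (node_belief w).
Proof.
move=> cB cm; have ps := nb_simplex w; have [p0 _] := ps.
have [x0 y0 xr E _] := f_optimal p0.
rewrite (node_split (g := loss c)); last by move=> t q t0 q0; rewrite loss_scale.
rewrite -[X in _ <= loss c X](addBfun (f (node_belief w))).
by apply: loss_split => //; rewrite addBfun.
Qed.

Lemma sum_loss c n : c \in breaks r -> cell r c m ->
  \sum_(w <- words n) len w * loss c (node_belief w) <= lam ^+ n * loss c p1.
Proof.
move=> cB cm; have /andP[l0 l1] := lam01; elim: n => [|n IH].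
  by rewrite big_seq1 len_nil expr0.
rewrite big_words_cons2 exprS -mulrA; apply: le_trans (ler_wpM2l l0 IH).
rewrite mulr_sumr; apply: ler_sum => w _ /=.
have h b : loss c (node_belief (b :: w)) <= lam * loss c (node_post w b).
  by apply: loss_phi => //; case: (np_simplex w b).
have pb b : 0 <= len w * node_prob w b.
  by rewrite mulr_ge0 //; case/andP: (node_prob01 m_simplex lam01 p1_simplex f_ge0 f_le w b).
have h1 := ler_wpM2l (pb true) (h true); have h2 := ler_wpM2l (pb false) (h false).
rewrite !len_cons; apply: (le_trans (lerD h1 h2)).
rewrite [leRHS]mulrCA; have := ler_wpM2l (mulr_ge0 (len0 w) l0) (node_loss w cB cm); lra.
Qed.

Lemma measurable_core : measurable ([set p | core p] : set Belief).
Proof.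
have -> : ([set p | core p] : set Belief) =
    \bigcup_(b in [set b | b \in breaks r /\ cell r b m]) [set p : Belief | cell r b p].
  apply/seteqP; split => p [b]; first by move=> [bB bm bp]; exists b.
  by move=> [bB bm] bp; exists b.
apply: fin_bigcup_measurable.
  by apply: (@sub_finite_set _ _ [set` breaks r]); [move=> b []|exact: finite_seq].
move=> b _.
have -> : [set p : Belief | cell r b p] = \bigcap_(w in setT) [set p : Belief | 0 <= p w] `&`
    \bigcap_(b' in [set` breaks r]) [set p : Belief | 0 <= dual r b' p - dual r b p].
  apply/seteqP; split => p.
    by move=> [p0 pb]; split=> [w _|b' b'B] /=; [exact: p0|rewrite subr_ge0 pb].
  by move=> [p0 pb]; split=> [w|b' b'B]; [exact: (p0 w)|rewrite -subr_ge0; exact: pb].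
apply: measurableI; apply: fin_bigcap_measurable => //.
  by move=> w _; apply: measurable_set_ge; exact: measurable_coord.
move=> b' _; apply: measurable_set_ge; apply: measurable_funB; exact: measurable_dotr.
Qed.

Lemma hist_sets_core n : hist_sets n [set x : nat -> Om -> R | core (belief M p1 n x)].
Proof.
by have := @measurable_belief _ _ m lam p1 n measurableT _ measurable_core; rewrite setTI.
Qed.

Lemma core_late : exists K, forall n,
  (1 - (lam ^+ n * K)%:E <= tree_law [set x : Path | core (belief M p1 n.+1 x)])%E.
Proof.
have [c [cB cm]] := core_exists r m_simplex.
have [eta e0 gap] := loss_gap m_simplex lam01 delta01 cB cm.
(* Markov's inequality for the posteriors of stage [n]: their expected loss is at most
   [lam ^+ n * loss c p1], and each one whose image under [phi] misses the core has loss at least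
   [eta]. That image is the next belief, hence [n.+1]. *)
exists (loss c p1 / eta) => n.
have mC : measurable [set x : Path | core (belief M p1 n.+1 x)].
  by apply: (@hist_sets_measurable _ _ n.+1); exact: hist_sets_core.
have EQ u : core (belief M p1 n.+1 (path_of u)) <-> core (node_belief (word n.+1 u)).
  have := on_node_belief (on_node_word m lam p1 f n.+1 u).
  by rewrite size_word => ->.
have E := tree_law_set m_simplex lam01 p1_simplex f_ge0 f_le (n := n.+1)
  (Q := fun w => core (node_belief w)) mC EQ.
rewrite -[leRHS]/(tree_law [set x : Path | core (belief M p1 n.+1 x)]) [leRHS]E.
rewrite -EFinB lee_fin -[X in X - _ <= _](sum_len m lam p1 f n.+1).
rewrite lerBlDl -lerBlDr -sumrB mulrA ler_pdivlMr //.
apply: le_trans (sum_loss n cB cm); rewrite mulr_suml big_words_cons2; apply: ler_sum => w _ /=.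
rewrite !len_cons.
have pb b : 0 <= len w * node_prob w b.
  by rewrite mulr_ge0 //; case/andP: (node_prob01 m_simplex lam01 p1_simplex f_ge0 f_le w b).
have h b : (len w * node_prob w b - len w * node_prob w b *
    (`[< core (node_belief (b :: w)) >])%:R) * eta <=
    len w * (node_prob w b * loss c (node_post w b)).
  rewrite mulrA; case: asboolP => [_|nc].
    rewrite mulr1 subrr mul0r mulr_ge0 // loss_ge0 //; first exact: breaks_ge0 cB.
    by case: (np_simplex w b).
  by rewrite mulr0 subr0 ler_wpM2l //; apply: gap.
have /= hl := ler_wpM2l (len0 w) (node_loss w cB cm).
have /= hh := lerD (h true) (h false); move: hl hh; lra.
Qed.

(** The belief at stage [n] is fixed by the earlier posteriors, so its entry into the core is known
    before the draw of that stage. *)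
Definition hit_time (x : Path) : option nat :=
  if pselect (exists n, `[< core (belief M p1 n x) >]) is left h
  then Some (ex_minn h) else None.

Lemma hit_timeP n x : (exists k, (k <= n)%N /\ hit_time x = Some k) <->
  (exists k, (k <= n)%N /\ core (belief M p1 k x)).
Proof.
rewrite /hit_time; case: pselect => [h|nh]; last first.
  by split=> -[k [kn]] // ck; exfalso; apply: nh; exists k; exact/asboolP.
case: ex_minnP => k /asboolP ck kmin; split.
  by move=> [k' [kn [e]]]; exists k; rewrite {1}e.
move=> [k' [kn ck']]; exists k; split => //.
by apply: leq_trans kn; apply: kmin; exact/asboolP.
Qed.

Lemma hit_time_stopping : stopping_time hit_time.
Proof.
move=> n.
have -> : [set x | exists k, (k <= n)%N /\ hit_time x = Some k] =
    \bigcup_(k in `I_n.+1) [set x : nat -> Om -> R | core (belief M p1 k x)].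
  apply/seteqP; split => x.
    by move/hit_timeP => [k [kn ck]]; exists k.
  by move=> [k kn ck]; apply/hit_timeP; exists k.
apply: (@fin_bigcup_measurable _ (Hist n)) => // k kn.
exact: hist_sets_le (@hist_sets_core k).
Qed.

Lemma hit_time_finite : tree_law [set x | hit_time x <> None] = 1%E.
Proof.
have [K hK] := core_late.
have mH : measurable [set x : Path | hit_time x <> None].
  rewrite (_ : [set x | _] = \bigcup_n [set x | exists k, (k <= n)%N /\ hit_time x = Some k]).
    apply: bigcupT_measurable => n; apply: (@hist_sets_measurable _ _ n).
    exact: hit_time_stopping.
  apply/seteqP; split => x /=.
    by case E : (hit_time x) => [k|//] _; exists k => //; exists k.
  by move=> [n _ [k [_ ->]]].
have le1 := probability_le1 tree_law mH.
have ge n : (1 - (lam ^+ n * K)%:E <= tree_law [set x | hit_time x <> None])%E.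
  apply: (le_trans (hK n)); apply: le_measure; rewrite ?inE //.
    by apply: (@hist_sets_measurable _ _ n.+1); exact: hist_sets_core.
  move=> x cx /=; have [|k [_ E]] := (hit_timeP n.+1 x).2; first by exists n.+1.
  by rewrite E.
have [v vE] : exists v, tree_law [set x | hit_time x <> None] = v%:E.
  exists (fine (tree_law [set x | hit_time x <> None])); rewrite fineK //.
  exact: fin_num_measure.
move: le1 ge; rewrite vE lee_fin => v1 ge; congr _%:E; apply/eqP; rewrite eq_le v1 /=.
apply: (@le_geometric _ lam _ _ K lam01) => n.
by have := ge n; rewrite -EFinB lee_fin lerBlDr.
Qed.

End optimal_strategy.

Unset Implicit Arguments.

Theorem theorem3 (R : realType) (Om : finType) (m : Om -> R) (lam : R)
    (r : Om -> R) (delta : R) (p1 : Om -> R) :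
  simplex m -> 0 <= lam < 1 -> irreducible (trans lam m) ->
  0 <= delta < 1 -> simplex p1 ->
  (exists q, inI r q) ->
  exists (s : strategy R Om) (P : probability (Path R Om) R),
    strategy_ok (trans lam m) p1 s /\ induced_law s P /\
    payoff r delta P = value (trans lam m) r delta p1 /\
    exists theta : Path R Om -> option nat,
      stopping_time theta /\
      P [set x | theta x <> None] = 1%E /\
      forall n (x : Path R Om), hist_ok n x ->
        (exists k, (k <= n)%N /\ theta x = Some k) ->
        greedy r (belief (trans lam m) p1 n x) (s n x).
Proof.
move=> ms l01 _ d01 ps Ine.
have [f fopt] := optimal_split_exists r ms l01 d01.
exists (strat m lam r p1 f), (tree_law m lam p1 f); split.
  exact: (strat_ok ms l01 ps fopt).
split; first exact: (strat_law ms l01 ps fopt).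
split; first exact: (payoff_value ms l01 d01 ps fopt).
exists (hit_time m lam r p1); split; first exact: hit_time_stopping.
split; first exact: (hit_time_finite ms l01 d01 ps fopt).
move=> n x hx /hit_timeP[k [kn ck]].
exact: (strat_greedy ms l01 ps Ine fopt hx kn ck).
Qed.
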